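(* When the linear system at each time level is solved by the matrix-free Krylov subspace method with the circulant preconditioner $\mathcal P^{(m)}$ described in the context, the fast scheme FIDS has $\mathcal O(NN_{exp})$ memory requirement and $\mathcal O\big(MN(\log N+N_{exp})\big)$ computational complexity, and the direct scheme DIDS has $\mathcal O(NM)$ memory requirement and $\mathcal O\big(MN(\log N+M)\big)$ computational complexity; here the operation counts are per preconditioned Krylov iteration, i.e. the number of iterations per time level is counted as $\mathcal O(1)$.
   Context: Let $0<\gamma<1$, $\alpha\in(0,2)$, $T>0$, $l>0$, and let $\kappa(x,t)>0$, $f(x,t)$, $\phi(x)$ be given. Let $M,N,r$ be positive integers, $h=2l/N$, $x_i=-l+ih$, $t_m=(m/M)^rT$, $\tau_m=t_m-t_{m-1}$, $\kappa_i^m=\kappa(x_i,t_m)$, $f_i^m=f(x_i,t_m)$, $K^{(m)}=\mathrm{diag}(\kappa_1^m,\dots,\kappa_{N-1}^m)$, $\boldsymbol f^m=(f_1^m,\dots,f_{N-1}^m)^\top$. Put $a^{(m,\gamma)}_k=\frac1{\tau_k}\int_{t_{k-1}}^{t_k}\frac{ds}{(t_m-s)^\gamma}$ for $1\le k\le m$. Let $\epsilon>0$, $\delta=(1/M)^rT$, and let $N_{exp}\in\mathbb N^+$, $s_j,w_j>0$ satisfy $\big|t^{-\gamma}-\sum_{j=1}^{N_{exp}}w_je^{-s_jt}\big|\le\epsilon$ on $[\delta,T]$; put $b^{(m,\gamma)}_k=\sum_{j=1}^{N_{exp}}w_j\frac1{\tau_k}\int_{t_{k-1}}^{t_k}e^{-s_j(t_m-s)}ds$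 for $1\le k\le m-1$ and $b^{(m,\gamma)}_m=a^{(m,\gamma)}_m$. Let $\mu\in(\alpha,2]$, $\nu=\mu-\alpha$, $\kappa_\mu=1$ if $\mu\in(\alpha,2)$ and $\kappa_\mu=2$ if $\mu=2$, $c_{1,\alpha}=\frac{2^{\alpha-1}\alpha\Gamma(\frac{\alpha+1}{2})}{\sqrt\pi\,\Gamma(1-\alpha/2)}$, $C^h_{\alpha,\mu}=\frac{c_{1,\alpha}}{\nu h^\alpha}$, and let $A=[a_{ij}]_{i,j=1,\dots,N-1}$ be the symmetric Toeplitz matrix $$a_{ij}=C^h_{\alpha,\mu}\begin{cases}\sum\limits_{\ell=2}^{N-1}\frac{(\ell+1)^\nu-(\ell-1)^\nu}{\ell^\mu}+\frac{N^\nu-(N-1)^\nu}{N^\mu}+(2^\nu+\kappa_\mu-1)+\frac{2\nu}{\alpha N^\alpha},& j=i,\\[2mm] -\frac{2^\nu+\kappa_\mu-1}{2},& j=i\pm1,\\[1mm] -\frac{(|j-i|+1)^\nu-(|j-i|-1)^\nu}{2|j-i|^\mu},& j\neq i,\,i\pm1.\end{cases}$$ With $\mathcal M^{(m)}=\frac1{\Gamma(1-\gamma)}b^{(m,\gamma)}_mI+K^{(m)}A$, FIDS computes successively, for $m=1,\dots,M$, the vector $\boldsymbol u^m\in\mathbb R^{N-1}$ from $$\mathcal M^{(m)}\boldsymbol u^m=\frac1{\Gamma(1-\gamma)}\Big[\sum_{k=1}^{m-1}\big(b^{(m,\gamma)}_{k+1}-b^{(m,\gamma)}_k\big)\boldsymbol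 u^k+b^{(m,\gamma)}_1\boldsymbol u^0\Big]+\boldsymbol f^m,\qquad \boldsymbol u^0=(\phi(x_1),\dots,\phi(x_{N-1}))^\top,$$ and DIDS is the same with every $b^{(m,\gamma)}_k$ replaced by $a^{(m,\gamma)}_k$. In FIDS the exponential sums allow the history term to be updated recursively from one time level to the next using $N_{exp}$ auxiliary vectors. The circulant preconditioner is $\mathcal P^{(m)}=\frac1{\Gamma(1-\gamma)}b^{(m,\gamma)}_mI+\kappa^{(m)}s(A)$, where $\kappa^{(m)}=\frac1{N-1}\sum_{i=1}^{N-1}\kappa_i^m$ and $s(A)$ is the circulant matrix of order $N-1$ with first column $[a_{11},\dots,a_{1,\lfloor (N+1)/2\rfloor},a_{1,\lfloor N/2\rfloor},\dots,a_{12}]^\top$. One iteration of the preconditioned Krylov method (such as CG or BiCGSTAB) consists of a bounded number of products $\mathcal M^{(m)}\boldsymbol v$, solves with $\mathcal P^{(m)}$, and $\mathcal O(N)$ further vector operations; products with Toeplitz matrices and solves with circulant matrices are carried out by fast Fourier transforms. Complexity is the number of arithmetic operations over all $M$ time levels, memory is the number of stored scalars. *)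

(* Defs.v *)
From HB Require Import structures.
From mathcomp Require Import all_boot all_order all_algebra.
From mathcomp Require Import all_classical all_reals all_analysis.

Set Implicit Arguments.
Unset Strict Implicit.
Unset Printing Implicit Defensive.

Import Order.TTheory GRing.Theory Num.Theory.
Import numFieldNormedType.Exports.

Local Open Scope classical_set_scope.
Local Open Scope ring_scope.

(** * The discrete problem *)

Definition Gamma {R : realType} (x : R) : R :=
  \int[lebesgue_measure]_(t in `]0, +oo[) (t `^ (x - 1) * expR (- t)).

Record problem (R : realType) := Problem {
  p_gamma : R; p_alpha : R; p_mu : R; p_T : R; p_l : R;
  p_kappa : R -> R -> R; p_f : R -> R -> R; p_phi : R -> R }.

Record admissible (R : realType) (D : problem R) : Prop := Admissible {
  adm_gamma : 0 < p_gamma D < 1;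
  adm_alpha : 0 < p_alpha D < 2;
  adm_mu : p_alpha D < p_mu D <= 2;
  adm_T : 0 < p_T D;
  adm_l : 0 < p_l D;
  adm_kappa : forall x t : R,
    - p_l D < x < p_l D -> 0 < t <= p_T D -> 0 < p_kappa D x t }.

(* Sum-of-exponentials approximation of t^(-gamma) on [delta, T]. *)
Record soe_approx (R : realType) (D : problem R) (M r Nexp : nat)
    (s w : 'I_Nexp -> R) (eps : R) : Prop := SoeApprox {
  soe_eps : 0 < eps;
  soe_s : forall j, 0 < s j;
  soe_w : forall j, 0 < w j;
  soe_err : forall t : R, M%:R^-1 ^+ r * p_T D <= t <= p_T D ->
    `|t `^ (- p_gamma D) - \sum_(j < Nexp) w j * expR (- s j * t)| <= eps }.

Section Discretization.
Context {R : realType} (D : problem R) (M N r : nat).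

Local Notation gam := (p_gamma D).
Local Notation alp := (p_alpha D).
Local Notation mu := (p_mu D).

Definition grid_x (i : nat) : R := - p_l D + i%:R * (2 * p_l D / N%:R).
Definition grid_t (m : nat) : R := (m%:R / M%:R) ^+ r * p_T D.
Definition tau (m : nat) : R := grid_t m - grid_t m.-1.

Definition coef_a (m k : nat) : R :=
  (tau k)^-1 * \int[lebesgue_measure]_(s in `[grid_t k.-1, grid_t k])
                 ((grid_t m - s) `^ gam)^-1.

Definition coef_b (Nexp : nat) (s w : 'I_Nexp -> R) (m k : nat) : R :=
  if k == m then coef_a m m else
  \sum_(j < Nexp) w j * ((tau k)^-1 *
     \int[lebesgue_measure]_(y in `[grid_t k.-1, grid_t k])
        expR (- s j * (grid_t m - y))).

Definition nu : R := mu - alp.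
Definition kappa_mu : R := if mu == 2 then 2 else 1.
Definition c1 : R :=
  2 `^ (alp - 1) * alp * Gamma ((alp + 1) / 2)
  / (Num.sqrt pi * Gamma (1 - alp / 2)).
Definition Ch : R := c1 / (nu * (2 * p_l D / N%:R) `^ alp).

(* Entry a_ij with i, j counted from 1; for naturals (i - j) + (j - i) is the
   distance |j - i|. *)
Definition entryA (i j : nat) : R :=
  let d := ((i - j) + (j - i))%N in
  Ch * match d with
       | 0 =>
           \sum_(2 <= q < N) ((q.+1)%:R `^ nu - (q.-1)%:R `^ nu) / q%:R `^ mu
           + (N%:R `^ nu - (N.-1)%:R `^ nu) / N%:R `^ mu
           + (2 `^ nu + kappa_mu - 1) + 2 * nu / (alp * N%:R `^ alp)
       | 1 => - ((2 `^ nu + kappa_mu - 1) / 2)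
       | _ => - (((d.+1)%:R `^ nu - (d.-1)%:R `^ nu) / (2 * d%:R `^ mu))
       end.

(* The ordinal i : 'I_N.-1 stands for the interior grid index i.+1. *)
Definition matA : 'M[R]_N.-1 := \matrix_(i, j) entryA i.+1 j.+1.

Definition circ_col : seq R :=
  [seq entryA 1 k | k <- iota 1 (N.+1)./2]
  ++ [seq entryA 1 k | k <- rev (iota 2 (N./2).-1)].

Definition circA : 'M[R]_N.-1 :=
  \matrix_(i, j) nth 0 circ_col ((i + (N.-1 - j)) %% N.-1).

Definition kappa_at (m : nat) (i : nat) : R := p_kappa D (grid_x i) (grid_t m).
Definition matK (m : nat) : 'M[R]_N.-1 :=
  diag_mx (\row_(i < N.-1) kappa_at m i.+1).
Definition kappa_mean (m : nat) : R :=
  (N.-1)%:R^-1 * \sum_(i < N.-1) kappa_at m i.+1.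
Definition vecf (m : nat) : 'cV[R]_N.-1 :=
  \col_(i < N.-1) p_f D (grid_x i.+1) (grid_t m).
Definition vec0 : 'cV[R]_N.-1 := \col_(i < N.-1) p_phi D (grid_x i.+1).

(* In what follows c is the family of time coefficients: coef_b for FIDS,
   coef_a for DIDS. *)
Definition sys_mx (c : nat -> nat -> R) (m : nat) : 'M[R]_N.-1 :=
  ((Gamma (1 - gam))^-1 * c m m)%:M + matK m *m matA.
Definition precond (c : nat -> nat -> R) (m : nat) : 'M[R]_N.-1 :=
  ((Gamma (1 - gam))^-1 * c m m)%:M + kappa_mean m *: circA.
Definition rhs (c : nat -> nat -> R) (u : nat -> 'cV[R]_N.-1) (m : nat)
    : 'cV[R]_N.-1 :=
  (Gamma (1 - gam))^-1 *:
    (\sum_(1 <= k < m) (c m k.+1 - c m k) *: u k + c m 1%N *: u 0%N) + vecf m.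

End Discretization.

(** * Preconditioned Krylov methods *)

Definition upd {T : Type} (f : nat -> T) (d : nat) (x : T) : nat -> T :=
  fun k => if k == d then x else f k.

Inductive binop := OAdd | OSub | OMul | ODiv | OPow | OLe.
Inductive unop := OSqrt | OExp | OCos | OSin | OGamma.

Definition eval_bin {R : realType} (o : binop) (x y : R) : R :=
  match o with
  | OAdd => x + y | OSub => x - y | OMul => x * y | ODiv => x / y
  | OPow => x `^ y | OLe => if x <= y then 1 else 0
  end.

Definition eval_un {R : realType} (o : unop) (x : R) : R :=
  match o with
  | OSqrt => Num.sqrt x | OExp => expR x | OCos => cos x | OSin => sin x
  | OGamma => Gamma x
  end.

(* One instruction is one system product, one preconditioner solve, or one
   O(N) vector or O(1) scalar operation; a method works on finitely many work
   vectors and scalars, whose number does not depend on the size of the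
   system. *)
Inductive kinstr :=
| KMul (d a : nat)
| KSolve (d a : nat)
| KAxpy (d c a b : nat)
| KMap (o : binop) (d a b : nat)
| KFill (d c : nat)
| KDot (d a b : nat)
| KLit (d n : nat)
| KUn (o : unop) (d a : nat)
| KBin (o : binop) (d a b : nat).

Record krylov := Krylov { k_init : seq kinstr; k_step : seq kinstr }.

Section KrylovSemantics.
Context {R : realType} {n : nat} (A P : 'M[R]_n).

Definition kstate := ((nat -> 'cV[R]_n) * (nat -> R))%type.

Definition kexec (st : kstate) (i : kinstr) : kstate :=
  let: (v, s) := st in
  match i with
  | KMul d a => (upd v d (A *m v a), s)
  | KSolve d a => (upd v d (invmx P *m v a), s)
  | KAxpy d c a b => (upd v d (s c *: v a + v b), s)
  | KMap o d a b => (upd v d (map2_mx (eval_bin o) (v a) (v b)), s)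
  | KFill d c => (upd v d (const_mx (s c)), s)
  | KDot d a b => (v, upd s d (\sum_i v a i 0 * v b i 0))
  | KLit d q => (v, upd s d q%:R)
  | KUn o d a => (v, upd s d (eval_un o (s a)))
  | KBin o d a b => (v, upd s d (eval_bin o (s a) (s b)))
  end.

Definition krun (p : seq kinstr) (st : kstate) : kstate := foldl kexec st p.

(* Vector 0 holds the iterate (initially the guess x0), vector 1 the right-hand
   side; all other work vectors and scalars start at zero. *)
Definition ksolve (kry : krylov) (it : nat) (x0 b : 'cV[R]_n) : 'cV[R]_n :=
  (iter it (krun (k_step kry))
     (krun (k_init kry) (upd (upd (fun=> 0) 0 x0) 1 b, fun=> 0))).1 0%N.

End KrylovSemantics.

(* Preconditioned CG.  Vectors: 2 residual, 3 preconditioned residual,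
   4 direction, 5 product; scalar 9 stays 0. *)
Definition pcg : krylov := Krylov
  [:: KMul 6 0; KMap OSub 2 1 6; KSolve 4 2; KDot 0 2 4]
  [:: KMul 5 4; KDot 1 4 5; KBin ODiv 2 0 1; KAxpy 0 2 4 0;
      KBin OSub 3 9 2; KAxpy 2 3 5 2; KSolve 3 2; KDot 1 2 3;
      KBin ODiv 2 1 0; KBin OAdd 0 1 9; KAxpy 4 2 4 3].

(* Preconditioned BiCGSTAB.  Vectors: 2 residual, 3 shadow residual,
   4 direction, (5, 6) and (7, 8) preconditioned vectors with their products;
   vector 9 and scalar 9 stay 0. *)
Definition pbicgstab : krylov := Krylov
  [:: KMul 6 0; KMap OSub 2 1 6; KMap OAdd 3 2 9; KMap OAdd 4 2 9; KDot 0 3 2]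
  [:: KSolve 5 4; KMul 6 5; KDot 1 3 6; KBin ODiv 1 0 1;
      KBin OSub 5 9 1; KAxpy 2 5 6 2; KSolve 7 2; KMul 8 7;
      KDot 2 8 2; KDot 3 8 8; KBin ODiv 2 2 3;
      KAxpy 0 1 5 0; KAxpy 0 2 7 0; KBin OSub 5 9 2;
      KAxpy 4 5 6 4; KAxpy 2 5 8 2; KDot 3 3 2;
      KBin ODiv 4 3 0; KBin ODiv 5 1 2; KBin OMul 4 4 5;
      KAxpy 4 4 4 2; KBin OAdd 0 3 9].

(* The vectors produced by the scheme with coefficients c when the system of
   level m is solved by it m iterations started from the previous level. *)
Definition scheme_levels {R : realType} (D : problem R) (M N r : nat)
    (kry : krylov) (it : nat -> nat) (c : nat -> nat -> R)
    (u : nat -> 'cV[R]_N.-1) : Prop :=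
  u 0%N = vec0 D N /\
  forall m, (0 < m <= M)%N ->
    u m = ksolve (sys_mx D M N r c m) (precond D M N r c m) kry (it m)
            (u m.-1) (rhs D M r c u m).

(** * Arithmetic cost model *)

(* Straight-line programs over registers that hold one real number each.
   Every instruction is one arithmetic operation; the elementary functions,
   the comparison OLe (with value 0 or 1) and the evaluations of phi, kappa, f
   count as one operation each.  Literals are natural numbers, so real data
   enter only through the initial registers and these evaluations. *)
Inductive instr :=
| ILit (d n : nat)
| IPi (d : nat)
| IUn (o : unop) (d a : nat)
| IBin (o : binop) (d a b : nat)
| IEvalPhi (d a : nat)
| IEvalKappa (d a b : nat)
| IEvalF (d a b : nat).

Definition exec {R : realType} (D : problem R) (st : nat -> R) (i : instr)
    : nat -> R :=
  match i with
  | ILit d n => upd st d n%:R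
  | IPi d => upd st d pi
  | IUn o d a => upd st d (eval_un o (st a))
  | IBin o d a b => upd st d (eval_bin o (st a) (st b))
  | IEvalPhi d a => upd st d (p_phi D (st a))
  | IEvalKappa d a b => upd st d (p_kappa D (st a) (st b))
  | IEvalF d a b => upd st d (p_f D (st a) (st b))
  end.

Definition run {R : realType} (D : problem R) (p : seq instr) (st : nat -> R)
    : nat -> R := foldl (exec D) st p.

Definition instr_regs (i : instr) : seq nat :=
  match i with
  | ILit d _ | IPi d => [:: d]
  | IUn _ d a | IEvalPhi d a => [:: d; a]
  | IBin _ d a b | IEvalKappa d a b | IEvalF d a b => [:: d; a; b]
  end.

(* A program is a list of blocks, one for each time level. *)
Definition num_ops (ps : seq (seq instr)) : nat := size (flatten ps).

(* Number of distinct registers in use, the ninp input registers included. *)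
Definition num_regs (ninp : nat) (ps : seq (seq instr)) : nat :=
  size (undup (iota 0 ninp ++ flatten (map instr_regs (flatten ps)))).

Definition scalars {R : realType} (D : problem R) : seq R :=
  [:: p_gamma D; p_alpha D; p_mu D; p_T D; p_l D].

(* The levels are not all kept in memory: after block m the registers out i
   contain u^m. *)
Definition computes_levels {R : realType} (D : problem R) (M n : nat)
    (inputs : seq R) (ps : seq (seq instr)) (out : 'I_n -> nat)
    (u : nat -> 'cV[R]_n) : Prop :=
  forall m (i : 'I_n), (0 < m <= M)%N ->
    run D (flatten (take m ps)) (nth 0 inputs) (out i) = u m i 0.

(* Main.v *)
Require Import Defs.
From HB Require Import structures.
From mathcomp Require Import all_boot all_order all_algebra.
From mathcomp Require Import all_classical all_reals all_analysis.
From mathcomp Require Import measurable_realfun complex zify ring lra.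

Set Implicit Arguments.
Unset Strict Implicit.
Unset Printing Implicit Defensive.

Import Order.TTheory GRing.Theory Num.Theory.
Import numFieldNormedType.Exports.

Local Open Scope ring_scope.

(** Why the bounds hold.

    Every quantity of the scheme is a closed expression in the inputs: the
    integrals in the time coefficients are elementary ([integral_powR],
    [integral_expR]), and the entries of the matrices are given by formulas.
    What remains is to evaluate matrix products, preconditioner solves and
    history sums with few operations and few registers.

    Products.  The matrix A is symmetric Toeplitz, hence a corner of a circulant
    matrix whose order is a power of two ([symtoep_cyc]); a circulant product is
    three radix-2 transforms and a pointwise product ([cyc_idft], [pdftS]), that
    is O(N log N) operations on O(N) numbers.

    Solves.  The preconditioner is circulant of order N - 1, so it is
    diagonalised by the transform of that order ([dft_circ_mul]), which
    Bluestein's identity reduces to a symmetric Toeplitz product again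
    ([bluestein]).  Inverting the eigenvalues inverts the matrix; if one of them
    vanishes the matrix is singular and [invmx] is the identity map, a case that
    the program detects from the eigenvalues ([circ_unit], [circ_solve]).

    History.  In DIDS all previous solutions are kept and the sum over them is
    evaluated afresh at each level: O(N M) registers and O(N M) operations per
    level.  In FIDS summation by parts isolates the coefficients
    ([rhs_by_parts]), and between two levels the contribution of each
    exponential to the past is multiplied by one common factor
    ([fids_hist_step]); one array per exponential and O(N) operations per
    exponential and level suffice.

    The programs are written in a language of simultaneous array assignments.
    [vcomp_correct] transports their meaning to the register machine, and
    [within] records length and register use, which add up under
    concatenation.  Levels share their registers, so the memory is a number of
    arrays, bounded in terms of the Krylov method plus the history, times their
    width, which is a power of two and at most 4 N. *)

(** * Array programs and their compilation to register code *)

Inductive expr (A : Type) :=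
| EIn (j : nat)
| EGet (a : A) (i : nat)
| ELit (n : nat)
| EPi
| EUn (o : unop) (e : expr A)
| EBin (o : binop) (e1 e2 : expr A)
| EPhi (e : expr A)
| EKappa (e1 e2 : expr A)
| EF (e1 e2 : expr A)
| ESum (n : nat) (f : nat -> expr A).

Arguments EIn {A} j.
Arguments ELit {A} n.
Arguments EPi {A}.

Declare Scope expr_scope.
Delimit Scope expr_scope with ex.
Bind Scope expr_scope with expr.
Notation "x + y" := (EBin OAdd x y) : expr_scope.
Notation "x - y" := (EBin OSub x y) : expr_scope.
Notation "x * y" := (EBin OMul x y) : expr_scope.
Notation "x / y" := (EBin ODiv x y) : expr_scope.
Notation "x `^ y" := (EBin OPow x y) : expr_scope.
Notation "x <= y" := (EBin OLe x y) : expr_scope.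

Fixpoint denote {R : realType} (D : problem R) {A : Type} (inp : nat -> R)
    (s : A -> nat -> R) (e : expr A) : R :=
  match e with
  | EIn j => inp j
  | EGet a i => s a i
  | ELit n => n%:R
  | EPi => pi
  | EUn o e => eval_un o (denote D inp s e)
  | EBin o e1 e2 => eval_bin o (denote D inp s e1) (denote D inp s e2)
  | EPhi e => p_phi D (denote D inp s e)
  | EKappa e1 e2 => p_kappa D (denote D inp s e1) (denote D inp s e2)
  | EF e1 e2 => p_f D (denote D inp s e1) (denote D inp s e2)
  | ESum n f => \sum_(i < n) denote D inp s (f i)
  end.

Fixpoint ecost {A : Type} (e : expr A) : nat :=
  match e with
  | EIn _ | EGet _ _ => 2
  | ELit _ | EPi => 1
  | EUn _ e | EPhi e => (ecost e).+1
  | EBin _ e1 e2 | EKappa e1 e2 | EF e1 e2 => (ecost e1 + ecost e2).+1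
  | ESum n f => (\sum_(i < n) (ecost (f i)).+1).+1
  end.

Fixpoint edepth {A : Type} (e : expr A) : nat :=
  match e with
  | EIn _ | EGet _ _ | ELit _ | EPi => 1
  | EUn _ e | EPhi e => edepth e
  | EBin _ e1 e2 | EKappa e1 e2 | EF e1 e2 => maxn (edepth e1) (edepth e2).+1
  | ESum n f => (\max_(i < n) edepth (f i)).+1
  end.

(** The evaluation stack does not grow with the problem: sums are accumulated in
    one register, so only the nesting of operations counts. *)
Definition stack_size : nat := 50.

Lemma edepth_gt0 A (e : expr A) : (0 < edepth e)%N.
Proof. by elim: e => //= *; rewrite leq_max orbT. Qed.

Lemma flatten_iotaS (T : Type) (f : nat -> seq T) k :
  flatten (map f (iota 0 k.+1)) = flatten (map f (iota 0 k)) ++ f k.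
Proof. by rewrite -[k.+1]addn1 iotaD map_cat flatten_cat /= cats0. Qed.

Lemma all_flatten (T : Type) (p : pred T) ss :
  all p (flatten ss) = all (all p) ss.
Proof. by elim: ss => //= s ss IH; rewrite all_cat IH. Qed.

Section ArrayMachine.
Context (A : finType).

(** An assignment computes all the entries of one array from the old contents,
    that array included; this is what a transform stage in place needs. *)
Definition vprog := seq (A * (nat -> expr A)).

Section Semantics.
Context {R : realType} (D : problem R) (W : nat) (inp : nat -> R).

Definition vexec (s : A -> nat -> R) (p : A * (nat -> expr A)) :=
  fun a i => if (a == p.1) && (i < W)%N then denote D inp s (p.2 i) else s a i.

Definition vrun (p : vprog) (s : A -> nat -> R) := foldl vexec s p.

Lemma vrun_cat p q s : vrun (p ++ q) s = vrun q (vrun p s).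
Proof. exact: foldl_cat. Qed.

Lemma vrun_frame p s a : a \notin map fst p -> vrun p s a = s a.
Proof.
elim: p s => //= -[d e] p IH s; rewrite inE negb_or => /andP[/negbTE ad ap].
by rewrite IH //; apply: funext => i; rewrite /vexec /= ad.
Qed.

Lemma vexec_at s d e i : (i < W)%N -> vexec s (d, e) d i = denote D inp s (e i).
Proof. by move=> iW; rewrite /vexec /= eqxx iW. Qed.

Lemma vexec_other s d e a : a != d -> vexec s (d, e) a = s a.
Proof. by move=> /negbTE ad; apply: funext => i; rewrite /vexec /= ad. Qed.

End Semantics.

Section Compilation.
Context (ninp W : nat).

(** Register layout: the inputs, a scratch array that makes the assignment of
    an array simultaneous, the arrays, and the evaluation stack. *)
Definition scratch i := (ninp + i)%N.
Definition addr (a : A) i := (ninp + W + enum_rank a * W + i)%N.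
Definition stack_base := (ninp + W + #|A| * W)%N.

Definition mv d a := [:: ILit d 0; IBin OAdd d a d].

Fixpoint compile (e : expr A) (t : nat) : seq instr :=
  match e with
  | EIn j => if (j < ninp)%N then mv t j else [:: ILit t 0]
  | EGet a i => if (i < W)%N then mv t (addr a i) else [:: ILit t 0]
  | ELit n => [:: ILit t n]
  | EPi => [:: IPi t]
  | EUn o e => rcons (compile e t) (IUn o t t)
  | EBin o e1 e2 => compile e1 t ++ rcons (compile e2 t.+1) (IBin o t t t.+1)
  | EPhi e => rcons (compile e t) (IEvalPhi t t)
  | EKappa e1 e2 => compile e1 t ++ rcons (compile e2 t.+1) (IEvalKappa t t t.+1)
  | EF e1 e2 => compile e1 t ++ rcons (compile e2 t.+1) (IEvalF t t t.+1)
  | ESum n f => ILit t 0 ::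
      flatten [seq rcons (compile (f i) t.+1) (IBin OAdd t t t.+1) | i <- iota 0 n]
  end.

Definition vcomp1 (p : A * (nat -> expr A)) : seq instr :=
  flatten [seq compile (p.2 i) stack_base ++ mv (scratch i) stack_base
          | i <- iota 0 W]
  ++ flatten [seq mv (addr p.1 i) (scratch i) | i <- iota 0 W].

Definition vcomp (p : vprog) : seq instr := flatten (map vcomp1 p).

Lemma vcomp_cat p q : vcomp (p ++ q) = vcomp p ++ vcomp q.
Proof. by rewrite /vcomp map_cat flatten_cat. Qed.

Lemma addr_inj a b i j : (i < W)%N -> (j < W)%N ->
  addr a i = addr b j -> a = b /\ i = j.
Proof.
move=> iW jW; rewrite /addr -!(addnA (ninp + W)) => /addnI e.
have W0 : (0 < W)%N by lia.
have := congr1 (fun k => (k %/ W)%N) e.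
rewrite !divnMDl // !divn_small // !addn0 => eab.
by split; [exact/enum_rank_inj/val_inj | move: e; rewrite eab => /addnI].
Qed.

Lemma addr_lt a i : (i < W)%N -> (addr a i < stack_base)%N.
Proof.
move=> iW; rewrite /addr /stack_base -addnA ltn_add2l.
have : ((enum_rank a).+1 * W <= #|A| * W)%N by rewrite leq_mul2r ltn_ord orbT.
by rewrite mulSn; lia.
Qed.

Lemma scratch_lt i : (i < W)%N -> (scratch i < ninp + W)%N.
Proof. by rewrite /scratch ltn_add2l. Qed.

Lemma addr_ge a i : (ninp + W <= addr a i)%N.
Proof. by rewrite /addr -addnA leq_addr. Qed.

Section Simulation.
Context {R : realType} (D : problem R) (inp : nat -> R).
Hypothesis inp_out : forall j, (ninp <= j)%N -> inp j = 0.

Definition simulates (st : nat -> R) (s : A -> nat -> R) : Prop :=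
  [/\ forall j, (j < ninp)%N -> st j = inp j,
      forall a i, (i < W)%N -> st (addr a i) = s a i
    & forall a i, (W <= i)%N -> s a i = 0].

Lemma run_cat p q (st : nat -> R) : run D (p ++ q) st = run D q (run D p st).
Proof. exact: foldl_cat. Qed.

Lemma run_rcons p i (st : nat -> R) :
  run D (rcons p i) st = exec D (run D p st) i.
Proof. exact: foldl_rcons. Qed.

Lemma run_mv d a (st : nat -> R) : a != d -> run D (mv d a) st = upd st d (st a).
Proof.
move=> ad; apply: funext => k.
by rewrite /run /= /upd eqxx (negbTE ad); case: eqP => // _; rewrite addr0.
Qed.

Lemma simulates_frame st st' s : simulates st s ->
  (forall r, (r < ninp)%N || (ninp + W <= r < stack_base)%N -> st' r = st r) ->
  simulates st' s.
Proof.
move=> [Hi Ha Ho] H; split=> // [j jI|a i iW]; first by rewrite H ?jI ?Hi.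
by rewrite H ?Ha // addr_ge addr_lt // orbT.
Qed.

(** An expression compiled at stack level [t] writes only to registers from [t]
    on, so a left operand survives the evaluation of the right one. *)
Lemma compile_correct e t st s : simulates st s -> (stack_base <= t)%N ->
  run D (compile e t) st t = denote D inp s e /\
  forall r, (r < t)%N -> run D (compile e t) st r = st r.
Proof.
have base_ge : (ninp + W <= stack_base)%N by rewrite leq_addr.
have stable st1 st2 t1 : simulates st1 s -> (stack_base <= t1)%N ->
    (forall r, (r < t1)%N -> st2 r = st1 r) -> simulates st2 s.
  move=> H1 ht H2; apply: (simulates_frame H1) => r /orP[|/andP[_]] rl;
    by apply: H2; lia.
have upd_lt (x : nat -> R) d y r : (r < d)%N -> upd x d y r = x r.
  by move=> rd; rewrite /upd (ltn_eqF rd).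
have upd_eq (x : nat -> R) d y : upd x d y d = y by rewrite /upd eqxx.
elim: e t st => [j|a i|n||o e IH|o e1 IH1 e2 IH2|e IH|e1 IH1 e2 IH2
                |e1 IH1 e2 IH2|n f IH] t st simS ht /=; have [Hi Ha Ho] := simS.
- case: ifP => [jI|/negbT]; last first.
    rewrite -leqNgt => /inp_out ->; split=> [|r rt]; first exact: upd_eq.
    exact: upd_lt.
  rewrite run_mv; last by apply/eqP; lia.
  by split=> [|r rt]; [rewrite upd_eq Hi | rewrite upd_lt].
- case: ifP => [iW|/negbT]; last first.
    rewrite -leqNgt => /Ho ->; split=> [|r rt]; first exact: upd_eq.
    exact: upd_lt.
  rewrite run_mv; last by apply/eqP; have := addr_lt a iW; lia.
  by split=> [|r rt]; [rewrite upd_eq Ha | rewrite upd_lt].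
- by split=> [|r rt]; [rewrite upd_eq | rewrite upd_lt].
- by split=> [|r rt]; [rewrite upd_eq | rewrite upd_lt].
- have [E F] := IH t st simS ht.
  by rewrite run_rcons /=; split=> [|r rt]; [rewrite upd_eq E | rewrite upd_lt ?F].
- have [E1 F1] := IH1 t st simS ht.
  have [E2 F2] := IH2 t.+1 _ (stable _ _ _ simS ht F1) (leqW ht).
  rewrite run_cat run_rcons /=; split=> [|r rt].
    by rewrite upd_eq E2 F2 ?E1.
  by rewrite upd_lt // F2 ?F1 // ltnW.
- have [E F] := IH t st simS ht.
  by rewrite run_rcons /=; split=> [|r rt]; [rewrite upd_eq E | rewrite upd_lt ?F].
- have [E1 F1] := IH1 t st simS ht.
  have [E2 F2] := IH2 t.+1 _ (stable _ _ _ simS ht F1) (leqW ht).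
  rewrite run_cat run_rcons /=; split=> [|r rt].
    by rewrite upd_eq E2 F2 ?E1.
  by rewrite upd_lt // F2 ?F1 // ltnW.
- have [E1 F1] := IH1 t st simS ht.
  have [E2 F2] := IH2 t.+1 _ (stable _ _ _ simS ht F1) (leqW ht).
  rewrite run_cat run_rcons /=; split=> [|r rt].
    by rewrite upd_eq E2 F2 ?E1.
  by rewrite upd_lt // F2 ?F1 // ltnW.
- set body := fun i => rcons _ _.
  have loop l st1 : simulates st1 s ->
      run D (flatten (map body l)) st1 t
        = st1 t + \sum_(i <- l) denote D inp s (f i) /\
      forall r, (r < t)%N -> run D (flatten (map body l)) st1 r = st1 r.
    elim: l st1 => [|i l IHl] st1 sim1 /=; first by rewrite big_nil addr0.
    rewrite run_cat.
    have [E F] := IH i t.+1 st1 sim1 (leqW ht).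
    have F' r : (r < t)%N -> run D (body i) st1 r = st1 r.
      by move=> rt; rewrite /body run_rcons /= upd_lt // F // ltnW.
    have [-> G] := IHl _ (stable _ _ _ sim1 ht F').
    split=> [|r rt]; last by rewrite G // F'.
    by rewrite big_cons addrA /body run_rcons /= upd_eq E F.
  have F0 r : (r < t)%N -> upd st t 0%:R r = st r by move=> rt; exact: upd_lt.
  have [E F] := loop (iota 0 n) _ (stable _ _ _ simS ht F0).
  split=> [|r rt]; last by rewrite /run /= -/(run D _ _) F // F0.
  by rewrite /run /= -/(run D _ _) E upd_eq add0r -{1}[n]subn0 big_mkord.
Qed.

Lemma vcomp1_correct p st s : simulates st s ->
  simulates (run D (vcomp1 p) st) (vexec D W inp s p).
Proof.
move=> simS; case: p => d e.
have base_ge : (ninp + W <= stack_base)%N by rewrite leq_addr.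
rewrite /vcomp1 run_cat /=; set st1 := run D _ st.
have [sim1 scr1] : simulates st1 s /\
    forall i, (i < W)%N -> st1 (scratch i) = denote D inp s (e i).
  rewrite {}/st1; set body := fun i => _ ++ _.
  have loop k : (k <= W)%N ->
      simulates (run D (flatten (map body (iota 0 k))) st) s /\
      forall i, (i < k)%N ->
        run D (flatten (map body (iota 0 k))) st (scratch i)
          = denote D inp s (e i).
    elim: k => [|k IH] kW //; have [simk scrk] := IH (ltnW kW).
    rewrite flatten_iotaS run_cat.
    have [E F] := compile_correct (e k) simk (leqnn stack_base).
    rewrite /body run_cat run_mv; last first.
      by apply/eqP; have := scratch_lt kW; lia.
    split=> [|i].
      apply: (simulates_frame simk) => r Hr.
      rewrite /upd; case: eqP => [rE|_]; last by rewrite F //; lia.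
      by move: Hr; rewrite rE; have := scratch_lt kW; rewrite /scratch; lia.
    rewrite ltnS leq_eqVlt => /predU1P[->|ik]; first by rewrite /upd eqxx.
    have iW : (i < W)%N by lia.
    have ik' : scratch i != scratch k by rewrite /scratch eqn_add2l; lia.
    by rewrite /upd (negbTE ik') F ?scrk //; have := scratch_lt iW; lia.
  have [sW] := loop W (leqnn _); split=> //.
set body := fun i => mv _ _.
have loop k : (k <= W)%N ->
    let st2 := run D (flatten (map body (iota 0 k))) st1 in
    [/\ forall r, (r < ninp + W)%N -> st2 r = st1 r,
        forall a i, (i < W)%N -> (a != d) || (k <= i)%N ->
          st2 (addr a i) = st1 (addr a i)
      & forall i, (i < k)%N -> st2 (addr d i) = denote D inp s (e i)].
  elim: k => [|k IH] kW; first by split.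
  have [S1 S2 S3] := IH (ltnW kW).
  rewrite flatten_iotaS run_cat.
  rewrite /body run_mv; last first.
    by apply/eqP; have := scratch_lt kW; have := addr_ge d k; lia.
  split=> [r rl|a i iW Hai|i].
  - rewrite /upd ifN ?S1 //; apply/eqP => rE.
    by have := addr_ge d k; lia.
  - rewrite /upd ifN ?S2 //; first by case/orP: Hai => [->//|?]; lia.
    apply/eqP => /(addr_inj iW kW)[ad ik].
    by move: Hai; rewrite ad eqxx ik /=; lia.
  - rewrite ltnS leq_eqVlt => /predU1P[->|ik].
      by rewrite /upd eqxx S1 ?scratch_lt // scr1.
    have iW : (i < W)%N by lia.
    rewrite /upd ifN ?S3 //; apply/eqP => /(addr_inj iW kW)[_ ?]; lia.
have [S1 S2 S3] := loop W (leqnn _); have [Hi Ha Ho] := sim1.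
split=> [j jI|a i iW|a i Wi].
- by rewrite S1 ?Hi //; lia.
- rewrite /vexec /=; case: eqP => [->|/eqP ad] /=; first by rewrite iW S3.
  by rewrite S2 ?ad ?Ha.
- by rewrite /vexec ltnNge Wi andbF Ho.
Qed.

Lemma vcomp_correct p st s : simulates st s ->
  simulates (run D (vcomp p) st) (vrun D W inp p s).
Proof.
elim: p st s => //= q p IH st s simS; rewrite run_cat.
exact/IH/vcomp1_correct.
Qed.

End Simulation.

(** Length and register use go together because both are inherited by
    concatenations; the register bound does not depend on the program. *)
Definition within (c : nat) (p : vprog) : Prop :=
  (size (vcomp p) <= c)%N /\
  all (fun i => all (ltn^~ (stack_base + stack_size)%N) (instr_regs i)) (vcomp p).

Lemma within_nil : within 0 [::]. Proof. by []. Qed.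

Lemma within_cat c1 c2 p q :
  within c1 p -> within c2 q -> within (c1 + c2) (p ++ q).
Proof.
move=> [s1 r1] [s2 r2]; split; rewrite vcomp_cat ?size_cat ?leq_add //.
by rewrite all_cat r1.
Qed.

Lemma within_leq c1 c2 p : within c1 p -> (c1 <= c2)%N -> within c2 p.
Proof. by move=> [s1 r1] c12; split=> //; exact: leq_trans c12. Qed.

Lemma size_compile e t : (size (compile e t) <= ecost e)%N.
Proof.
elim: e t => //= [j|a i|o e IH|o e1 IH1 e2 IH2|e IH|e1 IH1 e2 IH2
                |e1 IH1 e2 IH2|n f IH] t;
  rewrite ?size_cat ?size_rcons; try by case: ifP.
- by rewrite ltnS.
- by rewrite addnS ltnS leq_add.
- by rewrite ltnS.
- by rewrite addnS ltnS leq_add.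
- by rewrite addnS ltnS leq_add.
rewrite ltnS size_flatten /shape -map_comp sumnE big_map.
rewrite -{1}[n]subn0 big_mkord; apply: leq_sum => i _ /=.
by rewrite size_rcons ltnS.
Qed.

Lemma compile_regs e t B : (stack_base <= t)%N -> (t + edepth e <= B)%N ->
  all (fun i => all (ltn^~ B) (instr_regs i)) (compile e t).
Proof.
have base_ge : (ninp + W <= stack_base)%N by rewrite leq_addr.
elim: e t => [j|a i|n||o e IH|o e1 IH1 e2 IH2|e IH|e1 IH1 e2 IH2
                |e1 IH1 e2 IH2|n f IH] t ht /= hB;
  rewrite ?all_cat ?all_rcons /=.
- by case: ifP => jI /=; lia.
- by case: ifP => iW /=; [have := addr_lt a iW; lia | lia].
- by lia.
- by lia.
- by rewrite IH //; have := edepth_gt0 e; lia.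
- by rewrite IH1 ?IH2; have := edepth_gt0 e2; lia.
- by rewrite IH //; have := edepth_gt0 e; lia.
- by rewrite IH1 ?IH2; have := edepth_gt0 e2; lia.
- by rewrite IH1 ?IH2; have := edepth_gt0 e2; lia.
apply/andP; split; first by lia.
have : all (ltn^~ n) (iota 0 n) by apply/allP => k; rewrite mem_iota.
elim: (iota 0 n) => //= k l IHl /andP[kn /IHl]; rewrite all_cat => ->.
have := leq_bigmax (F := fun i : 'I_n => edepth (f i)) (Ordinal kn).
rewrite all_rcons /= => dk; have := edepth_gt0 (f k).
by rewrite IH; lia.
Qed.

(** Entry 0 is allowed an extra cost [b]: it holds the results of reductions and
    the long diagonal entry of the Toeplitz symbol. *)
Lemma within1 c b d (e : nat -> expr A) :
  (forall i, (i < W)%N -> (ecost (e i) <= c + (i == 0) * b)%N /\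
             (edepth (e i) <= stack_size)%N) ->
  within (W * (c + 4) + b) [:: (d, e)].
Proof.
move=> H; rewrite /within /vcomp /= cats0; split.
  rewrite /vcomp1 size_cat !size_flatten /shape -!map_comp !sumnE !big_map /=.
  rewrite -{1 2}[W]subn0 !big_mkord -big_split /=.
  have [->|W0] := posnP W; first by rewrite big_ord0.
  apply: (@leq_trans (\sum_(i < W) ((c + 4) + (i == Ordinal W0) * b))).
    apply: leq_sum => i _; rewrite size_cat /=.
    have := size_compile (e i) stack_base; have [+ _] := H i (ltn_ord i).
    rewrite -[i == Ordinal W0]/(nat_of_ord i == 0%N).
    by case: (nat_of_ord i == 0%N); rewrite ?mul0n ?mul1n; lia.
  rewrite big_split /= sum_nat_const card_ord leq_add2l.
  rewrite (bigD1 (Ordinal W0)) //= big1 ?mul1n ?addn0 // => i.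
  by move=> /negbTE ->.
rewrite /vcomp1 /= all_cat; apply/andP; split.
  rewrite all_flatten all_map; apply/allP => i; rewrite mem_iota.
  move=> /andP[_ iW] /=; rewrite all_cat compile_regs //= ?leq_add2l.
    by have := scratch_lt iW; rewrite /stack_base /stack_size; lia.
  exact: (H i iW).2.
rewrite all_flatten all_map; apply/allP => i; rewrite mem_iota.
move=> /andP[_ iW] /=; have := scratch_lt iW; have := addr_lt d iW.
by rewrite /stack_base; lia.
Qed.

Lemma num_regs_vcomp (ps : seq vprog) :
  all (fun i => all (ltn^~ (stack_base + stack_size)%N) (instr_regs i))
    (flatten (map vcomp ps)) ->
  (num_regs ninp (map vcomp ps) <= stack_base + stack_size)%N.
Proof.
rewrite -all_map -all_flatten => /allP H.
rewrite -[leqRHS](size_iota 0); apply: uniq_leq_size; first exact: undup_uniq.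
move=> r; rewrite mem_undup mem_cat !mem_iota add0n leq0n.
case/orP => [|/H //]; rewrite /stack_base; lia.
Qed.

End Compilation.
End ArrayMachine.

(** * Discrete Fourier transforms *)

Section DFT.
Context {R : realType}.
Local Notation C := (complex R).

Definition cis (x : R) : C := Complex (cos x) (sin x).

Lemma cisD x y : cis (x + y) = cis x * cis y.
Proof. by rewrite /cis cosD sinD; congr Complex; rewrite /= addrC. Qed.

Lemma cis0 : cis 0 = 1.
Proof. by rewrite /cis cos0 sin0. Qed.

Lemma cisX x n : cis x ^+ n = cis (n%:R * x).
Proof.
elim: n => [|n IH]; first by rewrite mul0r cis0 expr0.
by rewrite exprS IH -cisD -natr1 mulrDl mul1r addrC.
Qed.

Definition omega (n : nat) : C := cis (2 * pi / n%:R).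

Lemma omegaX n k : omega n ^+ k = cis ((2 * k)%:R * pi / n%:R).
Proof. by rewrite /omega cisX natrM; congr cis; ring. Qed.

Lemma omega_prim n : (0 < n)%N -> n.-primitive_root (omega n).
Proof.
move=> n0; have nR : n%:R != 0 :> R by rewrite pnatr_eq0 -lt0n.
apply/andP; split=> //; apply/forallP => i; rewrite unity_rootE.
rewrite omegaX; have [->|ni] := eqVneq i.+1 n.
  have -> : (2 * n)%:R * pi / n%:R = pi *+ 2 :> R by rewrite natrM; field.
  by rewrite /cis cos2pi sin2pi -[Complex 1 0]/(1 : C) eqxx.
apply/eqP; apply/negbTE.
(* cos (2 t) = 1 would force sin t = 0, here with 0 < t < pi. *)
have : 0 < sin (i.+1%:R * pi / n%:R : R).
  apply: sin_gt0_pi.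
  rewrite divr_gt0 ?mulr_gt0 ?pi_gt0 ?ltr0n //= ltr_pdivrMr ?ltr0n //.
  by rewrite mulrC ltr_pM2l ?pi_gt0 // ltr_nat; have := ltn_ord i; lia.
move=> s0; apply/eqP => /(congr1 (@complex.Re _)) /= /eqP.
rewrite (_ : _ / _ = (i.+1%:R * pi / n%:R) *+ 2); last by rewrite natrM; ring.
rewrite cos_mulr2n -subr_eq0 => /eqP h.
have := cos2Dsin2 (i.+1%:R * pi / n%:R : R).
have : 0 < sin (i.+1%:R * pi / n%:R : R) ^+ 2 by rewrite exprn_gt0.
by move: h; rewrite mulr2n => ? ? ?; lra.
Qed.

Lemma sum_prim_root (n : nat) (z : C) : (0 < n)%N -> z ^+ n = 1 ->
  \sum_(j < n) z ^+ j = if z == 1 then n%:R else 0.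
Proof.
move=> n0 zn; case: eqP => [->|/eqP z1].
  rewrite (eq_bigr (fun=> 1)) => [|i _]; last by rewrite expr1n.
  by rewrite sumr_const card_ord.
have : (z - 1) * \sum_(j < n) z ^+ j = 0 by rewrite -subrX1 zn subrr.
by move=> /eqP; rewrite mulf_eq0 subr_eq0 (negbTE z1) => /eqP.
Qed.

Definition dft (n : nat) (x : nat -> C) (k : nat) : C :=
  \sum_(j < n) x j * omega n ^+ (j * k).

(** A second forward transform, read backwards, inverts the first one: a single
    program serves both directions. *)
Definition idft (n : nat) (x : nat -> C) (k : nat) : C :=
  n%:R^-1 * dft n x ((n - k) %% n).

(** Cyclic convolution; the index is the one of the circulant matrices, written
    with truncated subtraction. *)
Definition cyc (n : nat) (c y : nat -> C) (k : nat) : C :=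
  \sum_(j < n) c ((k + (n - j)) %% n)%N * y j.

Lemma omega_mod n k : (0 < n)%N -> omega n ^+ (k %% n) = omega n ^+ k.
Proof. by move=> n0; rewrite (prim_expr_mod (omega_prim n0)). Qed.

Lemma eq_dft n x y k : (forall j, (j < n)%N -> x j = y j) ->
  dft n x k = dft n y k.
Proof. by move=> xy; apply: eq_bigr => i _; rewrite xy. Qed.

(** The sums over the powers of a root of unity other than 1 vanish. *)
Lemma dftK n x k : (k < n)%N -> idft n (dft n x) k = x k.
Proof.
move=> kn; have n0 : (0 < n)%N by lia.
have nC : n%:R != 0 :> C by rewrite pnatr_eq0 -lt0n.
rewrite /idft /dft; apply: (mulfI nC); rewrite mulVKf //.
under eq_bigr do rewrite mulr_suml.
rewrite exchange_big /= (bigD1 (Ordinal kn)) //= [X in _ + X]big1 => [|i ik].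
  rewrite addr0 (eq_bigr (fun=> x k)) => [|j _].
    by rewrite sumr_const card_ord mulr_natl.
  rewrite -mulrA -exprD -{2}[x k]mulr1; congr (_ * _).
  rewrite -omega_mod // -modnDmr modnMmr modnDmr [(j * (n - k))%N]mulnC.
  by rewrite -mulnDl subnKC 1?ltnW // modnMr expr0.
rewrite (eq_bigr (fun j : 'I_n => x i * (omega n ^+ (i + (n - k))) ^+ j));
    last first.
  move=> j _; rewrite -mulrA -exprM -exprD; congr (_ * _).
  rewrite -omega_mod // -modnDmr modnMmr modnDmr omega_mod //.
  by congr (_ ^+ _); rewrite mulnDl [(j * (n - k))%N]mulnC.
rewrite -mulr_sumr sum_prim_root //; last first.
  by rewrite -exprM mulnC exprM (prim_expr_order (omega_prim n0)) expr1n.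
rewrite -(expr0 (omega n)) (eq_prim_root_expr (omega_prim n0)) mod0n.
rewrite ifN ?mulr0 //; apply: contra ik => /eqP h; apply/eqP/val_inj => /=.
have /dvdnP[q] : (n %| i + (n - k))%N by rewrite /dvdn h.
by have := ltn_ord i; case: q => [|[|q]]; rewrite ?mulSn ?mul0n; lia.
Qed.

Lemma dft_cyc n c y k : (0 < n)%N ->
  dft n (cyc n c y) k = dft n c k * dft n y k.
Proof.
case: n => // n _; rewrite /dft /cyc.
under eq_bigr do rewrite mulr_suml.
rewrite exchange_big /= mulr_sumr; apply: eq_bigr => j _.
rewrite (reindex_inj (addIr j)) /= mulr_suml; apply: eq_bigr => i _.
have -> : ((i + j) %% n.+1 + (n.+1 - j) = (i + j + (n.+1 - j)) %[mod n.+1])%N.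
  by rewrite modnDml.
have -> : ((i + j + (n.+1 - j)) %% n.+1 = i)%N.
  by rewrite -addnA subnKC ?modnDr ?modn_small // ltnW.
rewrite -mulrA [RHS]mulrACA -mulrA; congr (_ * _).
rewrite -exprD; congr (_ * _).
by rewrite -omega_mod // modnMml omega_mod // mulnDl.
Qed.

Lemma cyc_idft n c y k : (k < n)%N ->
  cyc n c y k = idft n (fun j => dft n c j * dft n y j) k.
Proof.
move=> kn; rewrite -[LHS](@dftK n) //; congr (_ * _); apply: eq_dft => j _.
by rewrite dft_cyc //; lia.
Qed.

Lemma dft_inj n x y : (forall k, (k < n)%N -> dft n x k = dft n y k) ->
  forall k, (k < n)%N -> x k = y k.
Proof.
move=> H k kn; rewrite -[LHS](dftK x kn) -(dftK y kn).
by congr (_ * _); apply: eq_dft.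
Qed.

(** ** Radix-2 recursion *)

(** Partial transforms of decimation in time: [r] is the offset of the
    subsequence and [2 ^ (L - s)] its stride, so that [s = 0] is the data and
    [s = L] the full transform. *)
Definition pdft (x : nat -> C) (L s r k : nat) : C :=
  dft (2 ^ s) (fun j => x (r + 2 ^ (L - s) * j)%N) k.

Lemma dft_mod n x k : (0 < n)%N -> dft n x (k %% n) = dft n x k.
Proof.
move=> n0; apply: eq_bigr => j _; congr (_ * _).
by rewrite -omega_mod // modnMmr omega_mod.
Qed.

Lemma big_ord_double (n : nat) (F : nat -> C) :
  \sum_(j < 2 * n) F j
    = \sum_(j < n) F (2 * j)%N + \sum_(j < n) F (2 * j).+1.
Proof.
elim: n => [|n IH]; first by rewrite !big_ord0 addr0.
rewrite (_ : 2 * n.+1 = (2 * n).+2)%N; last by lia.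
by rewrite !big_ord_recr /= IH -!addrA; congr (_ + _); rewrite addrCA.
Qed.

Lemma omega_double n : (0 < n)%N -> omega (2 * n) ^+ 2 = omega n.
Proof.
move=> n0; rewrite omegaX /omega natrM; congr cis.
have nR : n%:R != 0 :> R by rewrite pnatr_eq0 -lt0n.
by field.
Qed.

(** The terms of even and of odd rank of a subsequence are subsequences of twice
    the stride; this is the butterfly of the fast transform. *)
Lemma pdftS x L s r k : (s < L)%N ->
  pdft x L s.+1 r k
    = pdft x L s r k
      + omega (2 ^ s.+1) ^+ k * pdft x L s (r + 2 ^ (L - s.+1)) k.
Proof.
move=> sL; have p0 : (0 < 2 ^ s)%N by rewrite expn_gt0.
rewrite /pdft /dft expnS.
rewrite (big_ord_double _ (fun j => x (r + 2 ^ (L - s.+1) * j)%N *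
  omega (2 * 2 ^ s) ^+ (j * k))) mulr_sumr.
have E : (2 ^ (L - s) = 2 * 2 ^ (L - s.+1))%N.
  by rewrite -expnS; congr (2 ^ _)%N; lia.
congr (_ + _); apply: eq_bigr => j _.
  rewrite E; congr (x _ * _); first by lia.
  by rewrite -[omega (2 ^ s)]omega_double // -exprM; congr (_ ^+ _); lia.
rewrite E mulrCA; congr (x _ * _); first by lia.
by rewrite -[omega (2 ^ s)]omega_double // -exprM -exprD; congr (_ ^+ _); lia.
Qed.

Lemma pdft0 x L r k : pdft x L 0 r k = x r.
Proof.
by rewrite /pdft /dft expn0 big_ord1 muln0 addn0 mul0n expr0 mulr1.
Qed.

Lemma pdft_full x L k : pdft x L L 0 k = dft (2 ^ L) x k.
Proof. by apply: eq_bigr => j _; rewrite subnn expn0 mul1n. Qed.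

(** ** Symmetric Toeplitz products and Bluestein's transform *)

Definition dist (i j : nat) : nat := ((i - j) + (j - i))%N.

Definition symtoep (n : nat) (g y : nat -> C) (k : nat) : C :=
  \sum_(j < n) g (dist k j) * y j.

(** The symbol, folded at [P / 2], defines a circulant matrix of order [P] with
    the symmetric Toeplitz matrix in its corner; [2 * n <= P] keeps the two
    branches of the fold apart. *)
Lemma symtoep_cyc n P g y k : (2 * n <= P)%N -> (k < n)%N ->
  cyc P (fun p => g (minn p (P - p))) (fun j => if (j < n)%N then y j else 0) k
    = symtoep n g y k.
Proof.
move=> nP kn; rewrite /cyc /symtoep.
rewrite (big_ord_widen P (fun j => g (dist k j) * y j)); last by lia.
rewrite [RHS]big_mkcond; apply: eq_bigr => -[j jP] _ /=.
case: ifP => [jn|]; last by rewrite mulr0.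
congr (g _ * _); rewrite /dist; have [jk|kj] := leqP j k.
  have -> : (k + (P - j) = k - j + P)%N by lia.
  by rewrite modnDr modn_small; lia.
by rewrite modn_small; lia.
Qed.

Definition chirp (n j : nat) : C := cis ((j * j)%:R * pi / n%:R).
Definition chirpV (n j : nat) : C := cis (- ((j * j)%:R * pi / n%:R)).

(** Since [2 j k = j ^ 2 + k ^ 2 - (k - j) ^ 2], the kernel of the transform is
    two diagonal factors around a function of the distance of [j] and [k]. *)
Lemma bluestein n x k : (0 < n)%N ->
  dft n x k = chirp n k * symtoep n (chirpV n) (fun j => chirp n j * x j) k.
Proof.
move=> n0; rewrite /symtoep mulr_sumr; apply: eq_bigr => j _.
rewrite omegaX /chirp /chirpV.
set ck := (k * k)%:R * pi / n%:R; set cj := (j * j)%:R * pi / n%:R.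
set cd := (dist k j * dist k j)%:R * pi / n%:R.
have -> : (2 * (j * k))%:R * pi / n%:R = ck + (- cd + cj).
  rewrite /ck /cd /cj.
  have -> : (dist k j * dist k j)%:R = (k%:R - j%:R) ^+ 2 :> R.
    rewrite natrM -expr2 /dist natrD; have [jk|kj] := leqP j k.
      by rewrite (eqP jk) addr0 natrB.
    have /eqP -> : (k - j == 0)%N by rewrite subn_eq0 ltnW.
    by rewrite add0r natrB 1?ltnW // -sqrrN opprB.
  by rewrite !natrM; ring.
by rewrite !cisD; ring.
Qed.

End DFT.

(** * Closed forms of the time coefficients *)

Section Integrals.
Local Open Scope classical_set_scope.
Context {R : realType}.
Local Notation mu := (@lebesgue_measure R).

Lemma integral_antiderivative (f F : R -> R) (a b : R) : a <= b ->
  (forall x : R, a <= x <= b -> is_derive x 1 F (f x)) ->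
  (forall x : R, a <= x <= b -> {for x, continuous f}) ->
  (\int[mu]_(x in `[a, b]) (f x)%:E = (F b - F a)%:E)%E.
Proof.
rewrite le_eqVlt => /predU1P[-> _ _|ab dF cf].
  by rewrite set_itv1 integral_set1 subrr.
have cF x : a <= x <= b -> {for x, continuous F}.
  move=> /dF xF; apply/differentiable_continuous/derivable1_diffP.
  exact: ex_derive.
have aab : a <= a <= b by rewrite lexx ltW.
have bab : a <= b <= b by rewrite lexx ltW.
rewrite (@continuous_FTC2 _ f F) ?EFinB //.
- apply: continuous_in_subspaceT => x; rewrite inE /= in_itv /=; exact: cf.
- split=> [x||]; rewrite ?in_itv /=.
  + by move=> /andP[/ltW ax /ltW xb]; have /dF ? : a <= x <= b by rewrite ax.
  + exact/cvg_at_right_filter/cF.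
  + exact/cvg_at_left_filter/cF.
- move=> x; rewrite in_itv /= => /andP[/ltW ax /ltW xb].
  rewrite derive1E; have /dF ? : a <= x <= b by rewrite ax.
  by rewrite derive_val.
Qed.

Lemma integral_expR (s t a b : R) : 0 < s -> a <= b ->
  \int[mu]_(y in `[a, b]) expR (- s * (t - y))
    = (expR (- s * (t - b)) - expR (- s * (t - a))) / s.
Proof.
move=> s0 ab; have sN0 : s != 0 by rewrite gt_eqF.
have dF (x : R) : a <= x <= b ->
    is_derive x 1 (fun y => expR (- s * (t - y)) / s) (expR (- s * (t - x))).
  by move=> _; apply: is_derive_eq; rewrite /GRing.scale /=; field.
have cf (x : R) : a <= x <= b -> {for x, continuous (fun y => expR (- s * (t - y)))}.
  move=> _; apply: differentiable_continuous; apply/derivable1_diffP.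
  exact: ex_derive.
by rewrite /Rintegral (integral_antiderivative ab dF cf) /= mulrBl.
Qed.

Lemma integral_powR_regular (g t a b : R) : 0 < g < 1 -> a <= b -> b < t ->
  (\int[mu]_(y in `[a, b]) (((t - y) `^ g)^-1)%:E
    = (((t - a) `^ (1 - g) - (t - b) `^ (1 - g)) / (1 - g))%:E)%E.
Proof.
move=> /andP[g0 g1] ab bt; have gN0 : 1 - g != 0 by rewrite gt_eqF // subr_gt0.
pose F := fun y => - ((t - y) `^ (1 - g) / (1 - g)).
have dpow (p x : R) : a <= x <= b ->
    is_derive x 1 (fun y => (t - y) `^ p) (- (p * (t - x) `^ (p - 1))).
  move=> /andP[_ xb]; have xt : 0 < t - x by rewrite subr_gt0; lra.
  have H := is_derive1_powR p xt.
  have H' : is_derive x 1 (fun y => t - y) (-1) by apply: is_derive_eq; ring.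
  have := @is_derive1_comp R (fun y => y `^ p) (fun y => t - y) x _ _ H H'.
  by rewrite mulrN1.
have dF (x : R) : a <= x <= b -> is_derive x 1 F (((t - x) `^ g)^-1).
  move=> /(dpow (1 - g)) H; apply: is_derive_eq.
  by rewrite -powRN (_ : 1 - g - 1 = - g) /GRing.scale /=; [field | ring].
have cf (x : R) : a <= x <= b ->
    {for x, continuous (fun y => ((t - y) `^ g)^-1)}.
  move=> xab; apply: (@cvgV _ _ _ _ (fun y => (t - y) `^ g)).
    by rewrite gt_eqF // powR_gt0 // subr_gt0; lra.
  have H := dpow g x xab.
  have : {for x, continuous (fun y => (t - y) `^ g)}.
    by apply: differentiable_continuous; apply/derivable1_diffP; exact: ex_derive.
  exact.
rewrite (integral_antiderivative ab dF cf) /F; congr EFin.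
by rewrite opprK addrC -mulrBl.
Qed.

(** The integrand is singular at the end point when [b = t]; the value is the
    limit of the regular integrals over an exhaustion of [a, t[. *)
Lemma integral_powR (g t a b : R) : 0 < g < 1 -> a <= b -> b <= t ->
  \int[mu]_(y in `[a, b]) ((t - y) `^ g)^-1
    = ((t - a) `^ (1 - g) - (t - b) `^ (1 - g)) / (1 - g).
Proof.
move=> g01 ab; rewrite le_eqVlt => /predU1P[bt|bt]; last first.
  by rewrite /Rintegral integral_powR_regular.
move: ab; rewrite {}bt => {b} at'.
have [g0 g1] := andP g01.
have gN0 : 1 - g != 0 by rewrite gt_eqF // subr_gt0.
rewrite subrr powR0 // subr0.
move: at'; rewrite le_eqVlt => /predU1P[->|at'].
  by rewrite set_itv1 Rintegral_set1 subrr powR0 // mul0r.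
(* The exhaustion: [a, t - e n] increases to [a, t[. *)
pose e (n : nat) : R := (t - a) / n.+1%:R.
have e0 n : 0 < e n by rewrite divr_gt0 ?subr_gt0 ?ltr0n.
have e_le n : e n <= t - a.
  by rewrite ler_pdivrMr ?ltr0n // ler_peMr ?ler1n // subr_ge0 ltW.
have mf (A : set R) : measurable_fun A (fun y : R => ((t - y) `^ g)^-1).
  apply: measurable_funTS.
  under eq_fun do rewrite -powRN.
  have mB : measurable_fun [set: R] (fun y : R => t - y).
    by apply: measurable_funB.
  exact: (measurableT_comp (measurable_powR (- g)) mB).
have cv : (\int[mu]_(y in `[a, (t - e n)%R]) (((t - y) `^ g)^-1)%:E)%E @[n --> \oo]
    --> (\int[mu]_(y in `[a, t[) (((t - y) `^ g)^-1)%:E)%E.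
  have -> : `[a, t[ = \bigcup_n `[a, t - e n].
    apply/seteqP; split=> x /=; rewrite in_itv /=.
      move=> /andP[ax xt].
      exists (Num.truncn ((t - a) / (t - x))) => //=; rewrite in_itv /= ax /=.
      rewrite lerBrDr -lerBrDl /e ler_pdivrMr ?ltr0n // mulrC.
      rewrite -ler_pdivrMr ?subr_gt0 //; apply/ltW/truncnS_gt.
    by move=> [n _ /=]; rewrite in_itv /= => /andP[-> xn]; have := e0 n; lra.
  apply: ge0_nondecreasing_set_cvg_integral => //; first last.
  - by move=> n x _; rewrite lee_fin invr_ge0 powR_ge0.
  - by move=> n; apply/measurable_EFinP; exact: mf.
  - apply/nondecreasing_seqP => n; rewrite subsetEset => x /=.
    rewrite !in_itv /= => /andP[-> xn] /=; apply: le_trans xn _.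
    rewrite lerD2l lerN2 /e ler_pM2l ?subr_gt0 //.
    by rewrite lef_pV2 ?posrE ?ltr0n // ler_nat.
have cv2 : (\int[mu]_(y in `[a, (t - e n)%R]) (((t - y) `^ g)^-1)%:E)%E @[n --> \oo]
    --> (((t - a) `^ (1 - g)) / (1 - g))%:E.
  under eq_fun => n.
    rewrite integral_powR_regular //; last by have := e0 n; lra.
    rewrite (_ : t - (t - e n) = e n); last by ring.
    over.
    by have := e_le n; lra.
  apply: cvg_EFin; first by near=> n.
  have -> : (t - a) `^ (1 - g) / (1 - g) = ((t - a) `^ (1 - g) - 0) / (1 - g).
    by rewrite subr0.
  apply: cvgMl; apply: cvgB; first exact: cvg_cst.
  have p0 : 0 < 1 - g by rewrite subr_gt0.
  have [+ _] := cvg_at_rightP (fun x => x `^ (1 - g)) 0 (0 : R).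
  move=> /(_ (powR_cvg0 p0)); apply.
  split=> //; have -> : 0 = (t - a) * 0 by rewrite mulr0.
  by apply: cvgMr; exact: cvg_harmonic.
have intE := cvg_unique (@ereal_hausdorff R) cv cv2.
rewrite /Rintegral -integral_itv_bndo_bndc; first by rewrite intE.
by apply/measurable_EFinP; exact: mf.
Unshelve. all: by end_near. Qed.

End Integrals.

(** * Fast transforms as array programs *)

(** The complex work arrays: data of the transforms, auxiliary copy, symbol of a
    convolution, eigenvalues of the preconditioner. *)
Definition carr := (bool * bool)%type.
Definition CX : carr := (false, false).
Definition CY : carr := (false, true).
Definition CS : carr := (true, false).
Definition CL : carr := (true, true).

(** A finite type of names: its enumeration gives the arrays disjoint blocks of
    registers.  A scalar of the Krylov method is entry 0 of an array [ASca]. *)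
Inductive array (v h : nat) :=
| ATmp | AMean | AFlag
| ARe (c : carr) | AIm (c : carr)
| AVec (i : 'I_v) | ASca (i : 'I_v) | AHist (i : 'I_h).

Arguments ATmp {v h}.
Arguments AMean {v h}.
Arguments AFlag {v h}.
Arguments ARe {v h} c.
Arguments AIm {v h} c.
Arguments AVec {v h} i.
Arguments ASca {v h} i.
Arguments AHist {v h} i.

Section ArrayFinType.
Context (v h : nat).

Definition array_code (a : array v h)
    : option (option (option (carr * bool + ('I_v * bool + 'I_h)))) :=
  match a with
  | ATmp => None
  | AMean => Some None
  | AFlag => Some (Some None)
  | ARe c => Some (Some (Some (inl (c, false))))
  | AIm c => Some (Some (Some (inl (c, true))))
  | AVec i => Some (Some (Some (inr (inl (i, false)))))
  | ASca i => Some (Some (Some (inr (inl (i, true)))))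
  | AHist i => Some (Some (Some (inr (inr i))))
  end.

Definition array_decode
    (x : option (option (option (carr * bool + ('I_v * bool + 'I_h)))))
    : array v h :=
  match x with
  | None => ATmp
  | Some None => AMean
  | Some (Some None) => AFlag
  | Some (Some (Some (inl (c, false)))) => ARe c
  | Some (Some (Some (inl (c, true)))) => AIm c
  | Some (Some (Some (inr (inl (i, false))))) => AVec i
  | Some (Some (Some (inr (inl (i, true))))) => ASca i
  | Some (Some (Some (inr (inr i)))) => AHist i
  end.

Lemma array_codeK : cancel array_code array_decode.
Proof. by case. Qed.

HB.instance Definition _ := Equality.copy (array v h) (can_type array_codeK).
HB.instance Definition _ := Choice.copy (array v h) (can_type array_codeK).
HB.instance Definition _ := Countable.copy (array v h) (can_type array_codeK).
HB.instance Definition _ := Finite.copy (array v h) (can_type array_codeK).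

Lemma arrayE :
  ((forall c c', (ARe c == ARe c' :> array v h) = (c == c')) *
   (forall c c', (AIm c == AIm c' :> array v h) = (c == c')) *
   (forall c c', (ARe c == AIm c' :> array v h) = false) *
   (forall c c', (AIm c == ARe c' :> array v h) = false) *
   (forall i i', (AVec i == AVec i' :> array v h) = (i == i')) *
   (forall i i', (ASca i == ASca i' :> array v h) = (i == i')) *
   (forall i i', (AHist i == AHist i' :> array v h) = (i == i')))%type.
Proof.
by do !split=> //; move=> a b; first [by apply/negbTE/eqP
  | by apply/eqP/eqP => [[]|->]].
Qed.

Lemma card_array : #|{: array v h}| = (11 + 2 * v + h)%N.
Proof.
rewrite -(card_codom (can_inj array_codeK)).
rewrite (eq_card (B := predT)) => [|x].
  by rewrite !card_option !card_sum !card_prod !card_bool !card_ord; lia.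
apply/codomP; exists (array_decode x).
by case: x => // -[] // [] // [[c []]|[[i []]|]].
Qed.

End ArrayFinType.

Section Transforms.
Context (v h n L : nat).
Local Notation arr := (array v h).
Local Notation W := (2 ^ L)%N.
Local Notation vprg := (vprog arr).

Definition cexpr := (expr arr * expr arr)%type.

Definition cget c i : cexpr := (EGet (ARe c) i, EGet (AIm c) i).
Definition czero : cexpr := (ELit 0, ELit 0).
Definition cadd (x y : cexpr) : cexpr := (x.1 + y.1, x.2 + y.2)%ex.
Definition cmul (x y : cexpr) : cexpr :=
  (x.1 * y.1 - x.2 * y.2, x.1 * y.2 + x.2 * y.1)%ex.
Definition cdiv (x : cexpr) (m : nat) : cexpr :=
  (x.1 / ELit m, x.2 / ELit m)%ex.
Definition angle (k m : nat) : expr arr := (ELit k * EPi / ELit m)%ex.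
Definition ccis k m : cexpr := (EUn OCos (angle k m), EUn OSin (angle k m)).
Definition ccisV k m : cexpr :=
  (EUn OCos (angle k m), ELit 0 - EUn OSin (angle k m))%ex.

(** The real part goes through a temporary array because both parts of the new
    value may depend on both parts of the old one. *)
Definition cset c (e : nat -> cexpr) : vprg :=
  [:: (ATmp, fun i => (e i).1); (AIm c, fun i => (e i).2);
      (ARe c, fun i => EGet ATmp i)].

(** Before the [s]-th stage, entry [k * 2 ^ (L - s) + r] of the array holds the
    partial transform [pdft x L s r k]; with this layout no bit reversal is
    needed. *)
Definition fft_stage s : vprg :=
  cset CX (fun i =>
    let q := (2 ^ (L - s.+1))%N in
    let k := (i %/ q)%N in
    let b := (k %% 2 ^ s * (2 * q) + i %% q)%N in
    cadd (cget CX b) (cmul (ccis (2 * k) (2 ^ s.+1)) (cget CX (b + q)))).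

Definition fft : vprg := flatten (map fft_stage (iota 0 L)).

Definition conv : vprg :=
  cset CY (cget CX) ++ cset CX (cget CS) ++ fft ++ cset CS (cget CX)
  ++ cset CX (cget CY) ++ fft
  ++ cset CX (fun i => cmul (cget CS i) (cget CX i)) ++ fft
  ++ cset CX (fun i => cdiv (cget CX ((W - i) %% W)) W).

Definition toeplitz (g : nat -> cexpr) : vprg :=
  cset CS (fun p => g (minn p (W - p))) ++ conv.

Definition chirp_mul : vprg :=
  cset CX (fun i =>
    if (i < n)%N then cmul (ccis (i * i) n) (cget CX i) else czero).

Definition dftn : vprg :=
  chirp_mul ++ toeplitz (fun d => ccisV (d * d) n) ++ chirp_mul.

Definition fft_work (a : arr) : bool :=
  match a with ATmp => true | ARe c | AIm c => c == CX | _ => false end.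

Definition conv_work (a : arr) : bool :=
  match a with ATmp => true | ARe c | AIm c => c != CL | _ => false end.

Definition writes (P : pred arr) (p : vprg) : bool := all (fun q => P q.1) p.

Lemma writes_cat P p q : writes P (p ++ q) = writes P p && writes P q.
Proof. exact: all_cat. Qed.

Lemma fft_writes : writes fft_work fft.
Proof. by rewrite /writes all_flatten all_map; apply/allP. Qed.

Lemma sub_writes (P Q : pred arr) p :
  (forall a, P a -> Q a) -> writes P p -> writes Q p.
Proof. by move=> PQ; apply: sub_all => x; exact: PQ. Qed.

Lemma conv_writes : writes conv_work conv.
Proof.
have F : writes conv_work fft.
  by apply: sub_writes fft_writes => -[] //= c /eqP ->.
by rewrite /conv !writes_cat F.
Qed.

Lemma toeplitz_writes g : writes conv_work (toeplitz g).
Proof. by rewrite /toeplitz writes_cat conv_writes. Qed.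

Lemma dftn_writes : writes conv_work dftn.
Proof. by rewrite /dftn writes_cat writes_cat toeplitz_writes. Qed.

Section Semantics.
Context {R : realType} (D : problem R) (inp : nat -> R).
Local Notation C := (complex R).
Local Notation state := (arr -> nat -> R).
Local Notation evalD := (denote D inp).
Local Notation run := (vrun D W inp).

Definition ceval (s : state) (e : cexpr) : C :=
  Complex (evalD s e.1) (evalD s e.2).

Definition cval (s : state) c i : C := Complex (s (ARe c) i) (s (AIm c) i).

Lemma ceval_get s c i : ceval s (cget c i) = cval s c i.
Proof. by []. Qed.

Lemma ceval_add s x y : ceval s (cadd x y) = ceval s x + ceval s y.
Proof. by []. Qed.

Lemma ceval_mul s x y : ceval s (cmul x y) = ceval s x * ceval s y.
Proof. by []. Qed.

Lemma ceval_div s x m : ceval s (cdiv x m) = m%:R^-1 * ceval s x.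
Proof.
rewrite /ceval /= -(rmorph_nat (real_complex R)) -fmorphV /=.
by congr Complex => /=; rewrite mul0r ?subr0 ?addr0 mulrC.
Qed.

Lemma ceval_cis s k m : ceval s (ccis k m) = cis (k%:R * pi / m%:R).
Proof. by []. Qed.

Lemma ceval_cisV s k m : ceval s (ccisV k m) = cis (- (k%:R * pi / m%:R)).
Proof. by rewrite /ceval /cis /= cosN sinN sub0r. Qed.

Lemma writes_frame P p s a : writes P p -> ~~ P a -> run p s a = s a.
Proof.
move=> wp Pa; apply: vrun_frame; apply: contra Pa.
by elim: p wp => //= q p IH /andP[Pq /IH]; rewrite inE => H /predU1P[->|/H].
Qed.

Lemma cval_frame P p s c : writes P p -> ~~ P (ARe c) -> ~~ P (AIm c) ->
  cval (run p s) c = cval s c.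
Proof.
move=> wp Pr Pi; apply: funext => i.
by rewrite /cval (writes_frame _ wp Pr) (writes_frame _ wp Pi).
Qed.

(** The condition says that the expressions do not read the temporary array. *)
Lemma run_cset c e s i : (i < W)%N ->
  (forall s', (forall a, a != ATmp -> s' a = s a) ->
     evalD s' (e i).2 = evalD s (e i).2) ->
  cval (run (cset c e) s) c i = ceval s (e i).
Proof.
move=> iW He; rewrite /cset /= /cval vexec_at // vexec_other ?arrayE //.
rewrite vexec_at // He; last by move=> a aT; rewrite vexec_other.
by rewrite /= vexec_other ?arrayE // vexec_at.
Qed.

Lemma cset_other c e s c' : c' != c -> cval (run (cset c e) s) c' = cval s c'.
Proof.
move=> /negbTE cc'; apply: funext => i.
by rewrite /cset /= /cval !vexec_other ?arrayE ?cc'.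
Qed.

Lemma fft_correct s i : (i < W)%N ->
  cval (run fft s) CX i = dft W (cval s CX) i.
Proof.
rewrite /fft -pdft_full.
have P1 : (2 ^ (L - L) = 1)%N by rewrite subnn.
suff H k : (k <= L)%N -> forall i, (i < W)%N ->
    cval (run (flatten (map fft_stage (iota 0 k))) s) CX i =
    pdft (cval s CX) L k (i %% 2 ^ (L - k)) (i %/ 2 ^ (L - k)).
  by move=> iW; rewrite H // P1 modn1 divn1.
elim: k => [|k IH] kL {}i iW.
  by rewrite subn0 pdft0 modn_small.
rewrite flatten_iotaS vrun_cat; set s1 := run _ s.
rewrite run_cset //; last by move=> s' Hs /=; rewrite !Hs.
rewrite ceval_add ceval_mul !ceval_get ceval_cis -omegaX.
set q := (2 ^ (L - k.+1))%N; set b := (_ + _)%N.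
have q0 : (0 < q)%N by rewrite expn_gt0.
have k0 : (0 < 2 ^ k)%N by rewrite expn_gt0.
have E : (2 ^ (L - k) = 2 * q)%N by rewrite -expnS; congr (2 ^ _)%N; lia.
have EW : (W = 2 ^ k * (2 * q))%N by rewrite -E -expnD; congr (2 ^ _)%N; lia.
have rq : (i %% q < q)%N by rewrite ltn_mod.
have kk : (i %/ q %% 2 ^ k < 2 ^ k)%N by rewrite ltn_mod.
have bW : (b + q < W)%N.
  rewrite EW /b; apply: (@leq_trans ((i %/ q %% 2 ^ k).+1 * (2 * q))).
    by rewrite mulSn; lia.
  by rewrite leq_mul2r kk orbT.
rewrite !IH ?E //; try lia.
have dm r : (r < 2 * q)%N ->
    ((i %/ q %% 2 ^ k * (2 * q) + r) %% (2 * q) = r)%N /\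
    ((i %/ q %% 2 ^ k * (2 * q) + r) %/ (2 * q) = i %/ q %% 2 ^ k)%N.
  move=> rl; have q2 : (0 < 2 * q)%N by lia.
  by rewrite modnMDl modn_small // divnMDl // (divn_small rl) addn0.
rewrite pdftS //; have [|-> ->] := dm (i %% q)%N; first by lia.
rewrite /b -addnA; have [|-> ->] := dm (i %% q + q)%N; first by lia.
by rewrite /pdft !(dft_mod _ _ k0).
Qed.

Lemma conv_correct s i : (i < W)%N ->
  cval (run conv s) CX i = cyc W (cval s CS) (cval s CX) i.
Proof.
move=> iW; have fft_other c t : c != CX -> cval (run fft t) c = cval t c.
  by move=> /negbTE cX; apply: (cval_frame _ fft_writes); rewrite /= cX.
have copy c c' t j : (j < W)%N -> cval (run (cset c (cget c')) t) c j = cval t c' j.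
  by move=> jW; rewrite run_cset // => s' Hs /=; rewrite Hs.
rewrite cyc_idft // /conv !vrun_cat.
set s1 := run (cset CY _) s; set s2 := run (cset CX (cget CS)) s1.
set s3 := run fft s2; set s4 := run (cset CS _) s3.
set s5 := run (cset CX (cget CY)) s4; set s6 := run fft s5.
set s7 := run (cset CX _) s6; set s8 := run fft s7.
have s4S j : (j < W)%N -> cval s4 CS j = dft W (cval s CS) j.
  move=> jW; rewrite /s4 copy // /s3 fft_correct //; apply: eq_dft => k kW.
  by rewrite /s2 copy // /s1 cset_other.
have s4Y j : (j < W)%N -> cval s4 CY j = cval s CX j.
  move=> jW; rewrite /s4 cset_other // /s3 fft_other // /s2 cset_other //.
  by rewrite /s1 copy.
have s6S j : (j < W)%N -> cval s6 CS j = dft W (cval s CS) j.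
  by move=> jW; rewrite /s6 fft_other // /s5 cset_other // s4S.
have s6X j : (j < W)%N -> cval s6 CX j = dft W (cval s CX) j.
  move=> jW; rewrite /s6 fft_correct //; apply: eq_dft => k kW.
  by rewrite /s5 copy // s4Y.
rewrite run_cset //; last by move=> s' Hs /=; rewrite !Hs.
rewrite ceval_div ceval_get /idft; congr (_ * _).
rewrite /s8 fft_correct ?ltn_mod ?expn_gt0 //; apply: eq_dft => j jW.
rewrite /s7 run_cset //; last by move=> s' Hs /=; rewrite !Hs.
by rewrite ceval_mul !ceval_get s6S ?s6X.
Qed.

Lemma toeplitz_correct g gv y s k : (2 * n <= W)%N ->
  (forall s i, ceval s (g i) = gv i) ->
  (forall j, (j < W)%N -> cval s CX j = if (j < n)%N then y j else 0) ->
  (k < n)%N -> cval (run (toeplitz g) s) CX k = symtoep n gv y k.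
Proof.
move=> nW Hg Hy kn; have kW : (k < W)%N by lia.
rewrite /toeplitz vrun_cat conv_correct // -(symtoep_cyc _ _ nW) //.
apply: eq_bigr => j _; congr (_ * _).
  rewrite run_cset ?Hg ?ltn_mod ?expn_gt0 // => s' _.
  have := Hg s' (minn ((k + (W - j)) %% W) (W - (k + (W - j)) %% W)).
  rewrite -(Hg s); exact: (congr1 (@complex.Im _)).
by rewrite cset_other // Hy.
Qed.

Lemma chirp_mul_correct s i : (i < W)%N ->
  cval (run chirp_mul s) CX i
    = if (i < n)%N then chirp n i * cval s CX i else 0.
Proof.
move=> iW; rewrite run_cset //; first by case: ifP.
by move=> s' Hs; case: ifP => // _ /=; rewrite !Hs.
Qed.

(** The order of the preconditioner is not under control, whence a transform of
    arbitrary order [n]; it leaves zeros beyond [n], as the next one expects. *)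
Lemma dftn_correct s i : (2 * n <= W)%N -> (i < W)%N ->
  cval (run dftn s) CX i = if (i < n)%N then dft n (cval s CX) i else 0.
Proof.
move=> nW iW; rewrite /dftn vrun_cat vrun_cat chirp_mul_correct //.
case: ifP => // ilt; rewrite bluestein; last by lia.
congr (_ * _); apply: toeplitz_correct => //.
- by move=> t d; rewrite ceval_cisV.
- by move=> j jW; rewrite chirp_mul_correct.
Qed.

End Semantics.
Section Cost.
Context (ninp : nat).
Local Notation within := (@within arr ninp W).

(** The length of a fast transform, up to a constant. *)
Definition work : nat := (W * L.+1)%N.

Lemma W_work : (W <= work)%N. Proof. by rewrite /work leq_pmulr. Qed.

Lemma cset_within c b B d (e : nat -> cexpr) :
  (forall i, (i < W)%N ->
     [/\ (ecost (e i).1 <= c + (i == 0) * b)%N,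
         (ecost (e i).2 <= c + (i == 0) * b)%N,
         (edepth (e i).1 <= stack_size)%N
       & (edepth (e i).2 <= stack_size)%N]) ->
  ((2 * c + 14) * W + 2 * b <= B)%N -> within B (cset d e).
Proof.
move=> H HB.
have W1 : within (W * (c + 4) + b) [:: (ATmp, fun i => (e i).1)].
  by apply: within1 => i /H[].
have W2 : within (W * (c + 4) + b) [:: (AIm d, fun i => (e i).2)].
  by apply: within1 => i /H[].
have W3 : within (W * (2 + 4) + 0) [:: (ARe d, fun i => EGet ATmp i)].
  by apply: within1 => i _; rewrite muln0.
by have /within_leq := within_cat W1 (within_cat W2 W3); apply; lia.
Qed.

Lemma fft_within : within (100 * work) fft.
Proof.
have stage s : within (100 * W) (fft_stage s).
  apply: (cset_within (c := 43) (b := 0)) => [i _|]; last by lia.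
  by rewrite muln0.
have stages l : within (size l * (100 * W)) (flatten (map fft_stage l)).
  elim: l => [|s l IH]; first exact: within_nil.
  by rewrite [size _]/= (mulSn (size l)); exact: within_cat (stage s) IH.
by apply: within_leq (stages (iota 0 L)) _; rewrite size_iota /work; lia.
Qed.

Lemma conv_within : within (600 * work) conv.
Proof.
have := W_work => ?; have F := fft_within.
have copy c c' : within (18 * W) (cset c (cget c')).
  apply: (cset_within (c := 2) (b := 0)) => [i _|]; last by lia.
  by rewrite muln0.
have mul : within (36 * W) (cset CX (fun i => cmul (cget CS i) (cget CX i))).
  apply: (cset_within (c := 11) (b := 0)) => [i _|]; last by lia.
  by rewrite muln0.
have div : within (22 * W) (cset CX (fun i => cdiv (cget CX ((W - i) %% W)) W)).
  apply: (cset_within (c := 4) (b := 0)) => [i _|]; last by lia.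
  by rewrite muln0.
rewrite /conv; apply: within_leq (within_cat (copy CY CX) (within_cat (copy CX CS)
  (within_cat F (within_cat (copy CS CX) (within_cat (copy CX CY) (within_cat F
  (within_cat mul (within_cat F div)))))))) _.
by lia.
Qed.

Lemma toeplitz_within c b (g : nat -> cexpr) :
  (forall i, [/\ (ecost (g i).1 <= c + (i == 0) * b)%N,
         (ecost (g i).2 <= c + (i == 0) * b)%N,
         (edepth (g i).1 <= stack_size)%N
       & (edepth (g i).2 <= stack_size)%N]) ->
  within ((614 + 2 * c) * work + 2 * b) (toeplitz g).
Proof.
move=> H; have := W_work => ?.
have S : within ((2 * c + 14) * W + 2 * b) (cset CS (fun p => g (minn p (W - p)))).
  apply: (cset_within (c := c) (b := b)) => // i iW; have := H (minn i (W - i)).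
  by have -> : (minn i (W - i) == 0)%N = (i == 0)%N by lia.
apply: within_leq (within_cat S conv_within) _.
by have : (c * W <= c * work)%N by [rewrite leq_mul2l W_work orbT]; lia.
Qed.

Lemma dftn_within : within (800 * work) dftn.
Proof.
have := W_work => ?.
have M : within (60 * W) chirp_mul.
  apply: (cset_within (c := 23) (b := 0)) => [i _|]; last by lia.
  by case: ifP => _; rewrite muln0.
have T : within (640 * work) (toeplitz (fun d => ccisV (d * d) n)).
  apply: within_leq; first by apply: (toeplitz_within (c := 10) (b := 0)) => i;
    rewrite muln0.
  by lia.
by apply: within_leq (within_cat M (within_cat T M)) _; lia.
Qed.

End Cost.
End Transforms.

(** * Expressions for the data of the scheme *)

Section Data.
Context {A : Type} (M N r : nat).
Local Notation ex := (expr A).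
Local Notation eGam := (EIn 0 : ex).
Local Notation eAlp := (EIn 1 : ex).
Local Notation eMu := (EIn 2 : ex).
Local Notation eT := (EIn 3 : ex).
Local Notation eL := (EIn 4 : ex).
Local Notation lit k := (ELit k : ex).

(** The first five inputs are gamma, alpha, mu, T and l; the exponents [s_j] of
    the sum of exponentials start at input 5. *)
Definition ex_x (i : nat) : ex :=
  (lit 0 - eL + lit i * (lit 2 * eL / lit N))%ex.
(** The literal exponent makes this one power, whatever the grading [r]. *)
Definition ex_t (m : nat) : ex := ((lit m / lit M) `^ lit r * eT)%ex.
Definition ex_tau (k : nat) : ex := (ex_t k - ex_t k.-1)%ex.
Definition ex_a (m k : nat) : ex :=
  (((ex_t m - ex_t k.-1) `^ (lit 1 - eGam)
    - (ex_t m - ex_t k) `^ (lit 1 - eGam)) / (lit 1 - eGam) / ex_tau k)%ex.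
Definition ex_gamma_inv : ex := (lit 1 / EUn OGamma (lit 1 - eGam))%ex.
Definition ex_b (j m k : nat) : ex :=
  ((EUn OExp ((lit 0 - EIn (5 + j)) * (ex_t m - ex_t k))
    - EUn OExp ((lit 0 - EIn (5 + j)) * (ex_t m - ex_t k.-1)))
   / EIn (5 + j) / ex_tau k)%ex.
Definition ex_kappa (m i : nat) : ex := EKappa (ex_x i) (ex_t m).
Definition ex_kappa_mean (m : nat) : ex :=
  (lit 1 / lit N.-1 * ESum N.-1 (fun i => ex_kappa m i.+1))%ex.
Definition ex_f (m i : nat) : ex := EF (ex_x i) (ex_t m).

Definition ex_nu : ex := (eMu - eAlp)%ex.
(** As [mu <= 2], the comparison tells whether [mu = 2]. *)
Definition ex_kappa_mu : ex := (lit 1 + (lit 2 <= eMu))%ex.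
Definition ex_Ch : ex :=
  (lit 2 `^ (eAlp - lit 1) * eAlp * EUn OGamma ((eAlp + lit 1) / lit 2)
   / (EUn OSqrt EPi * EUn OGamma (lit 1 - eAlp / lit 2))
   / (ex_nu * (lit 2 * eL / lit N) `^ eAlp))%ex.

Definition ex_diag : ex :=
  (ESum (N - 2) (fun q => (lit q.+3 `^ ex_nu - lit q.+1 `^ ex_nu)
                           / lit q.+2 `^ eMu)
   + (lit N `^ ex_nu - lit N.-1 `^ ex_nu) / lit N `^ eMu
   + (lit 2 `^ ex_nu + ex_kappa_mu - lit 1)
   + lit 2 * ex_nu / (eAlp * lit N `^ eAlp))%ex.

Definition ex_entry (d : nat) : ex :=
  (ex_Ch * match d with
           | 0 => ex_diag
           | 1 => lit 0 - (lit 2 `^ ex_nu + ex_kappa_mu - lit 1) / lit 2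
           | _ => lit 0 - (lit d.+1 `^ ex_nu - lit d.-1 `^ ex_nu)
                          / (lit 2 * lit d `^ eMu)
           end)%ex.

Definition ex_circ_col : seq ex :=
  [seq ex_entry k.-1 | k <- iota 1 (N.+1)./2]
  ++ [seq ex_entry k.-1 | k <- rev (iota 2 (N./2).-1)].

Lemma ex_entry_within d :
  (ecost (ex_entry d) <= 100 + (d == 0) * (50 * N))%N /\
  (edepth (ex_entry d) <= 10)%N.
Proof.
case: d => [|[|d]]; split=> //=; last first.
  set x := (\max_(_ < _) _)%N.
  have : (x <= 5)%N by apply/bigmax_leqP.
  by case: x => [|[|[|[|[|[|x]]]]]].
by rewrite sum_nat_const card_ord; lia.
Qed.

Lemma ex_circ_within p :
  (ecost (nth (ELit 0) ex_circ_col p) <= 100 + (p == 0) * (50 * N))%N /\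
  (edepth (nth (ELit 0) ex_circ_col p) <= 10)%N.
Proof.
have [pl|pl] := ltnP p (size ex_circ_col); last by rewrite nth_default.
have [d -> dp] : exists2 d, nth (ELit 0) ex_circ_col p = ex_entry d
                            & (0 < p)%N -> (0 < d)%N.
  move: pl; rewrite /ex_circ_col size_cat !size_map size_rev !size_iota nth_cat.
  rewrite size_map size_iota => pl; case: ltnP => pc.
    by rewrite (nth_map 0) ?size_iota // nth_iota //; exists p.
  rewrite (nth_map 0) ?size_rev ?size_iota; last by lia.
  eexists; first by [].
  move=> _; have : nth 0 (rev (iota 2 (N./2).-1)) (p - (N.+1)./2)
      \in rev (iota 2 (N./2).-1).
    by rewrite mem_nth // size_rev size_iota; lia.
  by rewrite mem_rev mem_iota; lia.
have [c1 c2] := ex_entry_within d; split=> //; apply: leq_trans c1 _.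
by rewrite leq_add2l leq_mul2r; case: (p) dp => [|q] /=; case: (d) => //; lia.
Qed.

Section Denotation.
Context {R : realType} (D : problem R) (inp : nat -> R).
Hypotheses (adm : admissible D) (M0 : (0 < M)%N) (r0 : (0 < r)%N).
Hypothesis inpE : forall i, (i < 5)%N -> inp i = nth 0 (scalars D) i.
Local Notation ev := (denote D inp).

Lemma denote_x s i : ev s (ex_x i) = grid_x D N i.
Proof. by rewrite /= !inpE //= sub0r. Qed.

Lemma denote_t s m : ev s (ex_t m) = grid_t D M r m.
Proof.
by rewrite /= !inpE //= powR_mulrn // divr_ge0.
Qed.

Lemma grid_t_le k m : (k <= m)%N -> grid_t D M r k <= grid_t D M r m.
Proof.
move=> km; rewrite /grid_t ler_pM2r ?(adm_T adm) //.
by rewrite lerXn2r ?nnegrE ?divr_ge0 // ler_pM2r ?invr_gt0 ?ltr0n // ler_nat.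
Qed.

Lemma denote_a s m k : (k <= m)%N -> ev s (ex_a m k) = coef_a D M r m k.
Proof.
move=> km; rewrite /coef_a integral_powR ?(adm_gamma adm) ?grid_t_le ?leq_pred //.
rewrite [LHS]mulrC; congr (_ * _); first by rewrite /tau -!(denote_t s).
by rewrite /= -!(denote_t s) /= !inpE.
Qed.

Lemma denote_gamma_inv s : ev s ex_gamma_inv = (Gamma (1 - p_gamma D))^-1.
Proof. by rewrite /= !inpE //= mul1r. Qed.

Lemma denote_b Nexp (sw : 'I_Nexp -> R) (w : 'I_Nexp -> R) s m k :
  (k < m)%N -> (forall j, 0 < sw j) -> (forall j : 'I_Nexp, inp (5 + j)%N = sw j) ->
  coef_b D M r sw w m k = \sum_(j < Nexp) w j * ev s (ex_b j m k).
Proof.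
move=> km s0 inps; rewrite /coef_b (ltn_eqF km); apply: eq_bigr => j _.
rewrite integral_expR ?s0 ?grid_t_le ?leq_pred //; congr (_ * _).
rewrite [LHS]mulrC /tau -!(denote_t s) /= inps.
by rewrite !sub0r.
Qed.

Lemma denote_kappa s m i : ev s (ex_kappa m i) = kappa_at D M N r m i.
Proof. by rewrite /kappa_at -(denote_x s) -(denote_t s). Qed.

Lemma denote_kappa_mean s m : ev s (ex_kappa_mean m) = kappa_mean D M N r m.
Proof.
rewrite /kappa_mean; under eq_bigr do rewrite -(denote_kappa s).
by rewrite /= mul1r.
Qed.

Lemma denote_f s m i : ev s (ex_f m i) = p_f D (grid_x D N i) (grid_t D M r m).
Proof. by rewrite -(denote_x s) -(denote_t s). Qed.

Lemma denote_Ch s : ev s ex_Ch = Ch D N.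
Proof. by rewrite /= !inpE. Qed.

Lemma denote_entry s i j : ev s (ex_entry (dist i j)) = entryA D N i j.
Proof.
rewrite /entryA -/(dist i j).
have kmu : 1 + (if 2 <= p_mu D then 1 else 0) = kappa_mu D.
  rewrite /kappa_mu eq_le; have /andP[_ ->] := adm_mu adm.
  by case: ifP; rewrite ?addr0.
rewrite -[LHS]/(ev s ex_Ch * ev s _) denote_Ch; congr (_ * _).
have sumE (F : nat -> R) : \sum_(2 <= q < N) F q = \sum_(q < N - 2) F q.+2.
  rewrite (big_addn 0 N 2) big_mkord.
  by apply: eq_bigr => q _; rewrite addn2.
by case: (dist i j) => [|[|d]] /=; rewrite !inpE //= ?kmu ?sub0r // sumE.
Qed.

Lemma denote_circ s p :
  ev s (nth (ELit 0) ex_circ_col p) = nth 0 (circ_col D N) p.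
Proof using adm inpE.
have -> : circ_col D N = [seq ev s e | e <- ex_circ_col].
  rewrite /circ_col /ex_circ_col map_cat -!map_comp; congr (_ ++ _);
    apply/eq_in_map => k /=; rewrite -(denote_entry s) /dist; clear M0 r0.
    by rewrite mem_iota => /andP[k1 _]; congr (ev s (ex_entry _)); lia.
  by rewrite mem_rev mem_iota => /andP[k1 _]; congr (ev s (ex_entry _)); lia.
have [pl|pl] := ltnP p (size ex_circ_col); first by rewrite (nth_map (ELit 0)).
by rewrite !nth_default ?size_map.
Qed.

End Denotation.
End Data.

(** * Circulant systems *)

Section Circulant.
Context {R : realType} (n : nat).
Local Notation C := (complex R).
Local Notation toC := (real_complex R).

(** Column vectors as sequences, extended by zero. *)
Definition vseq (w : 'cV[R]_n) (j : nat) : R :=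
  if insub j is Some k then w k 0 else 0.

Lemma vseq_ord w (i : 'I_n) : vseq w i = w i 0.
Proof. by rewrite /vseq valK. Qed.

Context (P : 'M[R]_n) (c : nat -> R).
Hypothesis P_circ : forall i j : 'I_n, P i j = c ((i + (n - j)) %% n)%N.
Local Notation cC := (fun j => toC (c j)).
Local Notation vC w := (fun j => toC (vseq w j)).

Definition circ_eig (k : nat) : C := dft n cC k.

Lemma circ_mul w k : (k < n)%N -> toC (vseq (P *m w) k) = cyc n cC (vC w) k.
Proof.
move=> kn; rewrite -[k]/(nat_of_ord (Ordinal kn)) vseq_ord mxE rmorph_sum /=.
by apply: eq_bigr => j _; rewrite P_circ vseq_ord rmorphM.
Qed.

Lemma dft_circ_mul w k : (0 < n)%N ->
  dft n (vC (P *m w)) k = circ_eig k * dft n (vC w) k.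
Proof.
by move=> n0; rewrite -dft_cyc //; apply: eq_dft => j jn; exact: circ_mul.
Qed.

Lemma vseq_inj w w' : (forall k, (k < n)%N -> dft n (vC w) k = dft n (vC w') k) ->
  w = w'.
Proof.
move=> H; apply/colP => i; have := dft_inj H (ltn_ord i).
by rewrite !vseq_ord => /complexI.
Qed.

(** A vector with a given image has Fourier coefficients divided by the
    eigenvalues; if an eigenvalue vanishes, no vector is mapped to a unit vector,
    all of whose Fourier coefficients are nonzero. *)
Lemma circ_unit : P \in unitmx = [forall k : 'I_n, circ_eig k != 0].
Proof.
have [n0|n0] := posnP n.
  rewrite unitmxE; have -> : [forall k : 'I_n, circ_eig k != 0].
    by apply/forallP => -[k kn]; exfalso; rewrite n0 in kn.
  by move: P; rewrite n0 => Q; rewrite det_mx00 unitr1.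
apply/idP/forallP => [Pu k|H].
  apply/eqP => k0; pose e : 'cV[R]_n := delta_mx k 0.
  have := dft_circ_mul (invmx P *m e) k n0.
  rewrite mulKVmx // k0 mul0r /dft (bigD1 k) //= big1 => [|j jk].
    rewrite addr0 vseq_ord mxE !eqxx rmorph1 mul1r => /eqP.
    rewrite expf_eq0 => /andP[_]; rewrite /omega => /eqP h.
    have := cisD (2 * pi / n%:R) (- (2 * pi / n%:R) : R).
    by rewrite h mul0r subrr cis0 => /eqP; rewrite oner_eq0.
  by rewrite vseq_ord mxE (negbTE jk) /= rmorph0 mul0r.
rewrite -unitmx_tr -row_free_unit; apply: inj_row_free => w wP.
have Pw : P *m w^T = 0 by apply: trmx_inj; rewrite trmx_mul trmxK wP trmx0.
apply: trmx_inj; rewrite trmx0; apply: vseq_inj => k kn.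
apply: (mulfI (H (Ordinal kn) : circ_eig k != 0)).
have E w' := dft_circ_mul w' k n0.
by rewrite -E -(E 0) Pw mulmx0.
Qed.

(** Outside the invertible matrices [invmx] is the identity map, so the
    eigenvalues of [invmx P] are those of [P] when one of them vanishes. *)
Definition circ_inv_eig (k : nat) : C :=
  if [forall k : 'I_n, circ_eig k != 0] then (circ_eig k)^-1 else circ_eig k.

Lemma circ_solve w k : (k < n)%N ->
  toC (vseq (invmx P *m w) k)
    = idft n (fun j => circ_inv_eig j * dft n (vC w) j) k.
Proof.
move=> kn; have n0 : (0 < n)%N by lia.
rewrite /circ_inv_eig -circ_unit; case: (boolP (P \in unitmx)) => [Pu|Pu].
  rewrite -[LHS](dftK (vC (invmx P *m w)) kn); congr (_ * _).
  apply: eq_dft => j jn; rewrite -{2}[w](mulKVmx Pu) dft_circ_mul //.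
  rewrite mulKf //; move: Pu; rewrite circ_unit => /forallP.
  exact: (fun H => H (Ordinal jn)).
rewrite /invmx (negbTE Pu) circ_mul //; exact: cyc_idft.
Qed.

End Circulant.

(** * Krylov methods as array programs *)

Section Krylov.
(** [kv] bounds the indices of the work vectors and scalars of the method. *)
Context (kv h M N r L : nat).
Local Notation n := (N.-1).
Local Notation W := (2 ^ L)%N.
Local Notation arr := (array kv.+1 h).
Local Notation vprg := (vprog arr).
Local Notation cget := (@cget kv.+1 h).
Local Notation czero := (czero kv.+1 h).

Definition vec (d : nat) : arr := AVec (inord d).
Definition scal (d : nat) : arr := ASca (inord d).

Definition work_arr (a : arr) : bool :=
  match a with AVec _ | ASca _ | AHist _ => false | _ => true end.

Definition no_hist (a : arr) : bool := if a is AHist _ then false else true.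

(** The coefficient of the identity; it is the same in both schemes because
    their coefficients of index [m m] agree. *)
Definition ex_sigma (m : nat) : expr arr :=
  (ex_gamma_inv * ex_a M r m m)%ex.

Definition load (a : arr) : vprg :=
  cset CX (fun i => if (i < n)%N then (EGet a i, ELit 0) else czero).

Definition mul_work (a : nat) : vprg :=
  load (vec a) ++ toeplitz L (fun d => (ex_entry N d, ELit 0)).

Definition mul_prog (m d a : nat) : vprg :=
  mul_work a ++
  [:: (vec d, fun i => if (i < n)%N
         then (ex_sigma m * EGet (vec a) i
               + ex_kappa M N r m i.+1 * EGet (ARe CX) i)%ex
         else ELit 0)].

Definition ex_precond_col (m p : nat) : expr arr :=
  ((if p == 0%N then ex_sigma m else ELit 0)
   + EGet AMean 0 * nth (ELit 0) (ex_circ_col N) p)%ex.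

Definition ex_sqnorm (j : nat) : expr arr :=
  (EGet (ARe CL) j * EGet (ARe CL) j + EGet (AIm CL) j * EGet (AIm CL) j)%ex.

(** A straight-line program cannot branch on the singular case, so the choice in
    [circ_inv_eig] is made by blending with a flag, which is 1 if no eigenvalue
    vanishes and 0 otherwise. *)
Definition ex_flag : expr arr :=
  (ESum n (fun j => ex_sqnorm j <= ELit 0) <= ELit 0)%ex.

Definition ex_inv_eig (i : nat) : cexpr kv.+1 h :=
  (EGet AFlag 0 * (EGet (ARe CL) i / ex_sqnorm i)
     + (ELit 1 - EGet AFlag 0) * EGet (ARe CL) i,
   EGet AFlag 0 * (ELit 0 - EGet (AIm CL) i / ex_sqnorm i)
     + (ELit 1 - EGet AFlag 0) * EGet (AIm CL) i)%ex.

Definition eig_work (m : nat) : vprg :=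
  [:: (AMean, fun i => if i == 0%N then ex_kappa_mean M N r m else ELit 0)]
  ++ cset CX (fun p => if (p < n)%N then (ex_precond_col m p, ELit 0) else czero)
  ++ dftn kv.+1 h n L ++ cset CL (cget CX)
  ++ [:: (AFlag, fun i => if i == 0%N then ex_flag else ELit 0)].

Definition solve_work (m a : nat) : vprg :=
  eig_work m ++ load (vec a) ++ dftn kv.+1 h n L
  ++ cset CX (fun i => cmul (ex_inv_eig i) (cget CX i))
  ++ dftn kv.+1 h n L.

Definition solve_prog (m d a : nat) : vprg :=
  solve_work m a ++
  [:: (vec d, fun i => if (i < n)%N
         then (EGet (ARe CX) ((n - i) %% n) / ELit n)%ex else ELit 0)].

Definition kcomp (m : nat) (i : kinstr) : vprg :=
  match i with
  | KMul d a => mul_prog m d a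
  | KSolve d a => solve_prog m d a
  | KAxpy d c a b =>
      [:: (vec d, fun i => EGet (scal c) 0 * EGet (vec a) i + EGet (vec b) i)%ex]
  | KMap o d a b => [:: (vec d, fun i => EBin o (EGet (vec a) i) (EGet (vec b) i))]
  | KFill d c => [:: (vec d, fun=> EGet (scal c) 0)]
  | KDot d a b =>
      [:: (scal d, fun i => if i == 0
             then ESum n (fun j => EGet (vec a) j * EGet (vec b) j)%ex
             else ELit 0)]
  | KLit d q => [:: (scal d, fun=> ELit q)]
  | KUn o d a => [:: (scal d, fun=> EUn o (EGet (scal a) 0))]
  | KBin o d a b => [:: (scal d, fun=> EBin o (EGet (scal a) 0) (EGet (scal b) 0))]
  end.

Definition kindices (i : kinstr) : seq nat :=
  match i with
  | KMul d a | KSolve d a | KUn _ d a | KFill d a => [:: d; a]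
  | KAxpy d c a b => [:: d; c; a; b]
  | KMap _ d a b | KDot d a b | KBin _ d a b => [:: d; a; b]
  | KLit d _ => [:: d]
  end.

Definition kbounded (p : seq kinstr) : bool :=
  all (fun i => all (leq^~ kv) (kindices i)) p.

Lemma load_writes a : writes (@conv_work kv.+1 h) (load a).
Proof. by []. Qed.

Lemma conv_work_arr (a : arr) : conv_work a -> work_arr a.
Proof. by case: a. Qed.

Lemma work_arr_no_hist (a : arr) : work_arr a -> no_hist a.
Proof. by case: a. Qed.

Lemma mul_work_writes a : writes work_arr (mul_work a).
Proof.
apply: sub_writes conv_work_arr _.
by rewrite /mul_work writes_cat load_writes toeplitz_writes.
Qed.

Lemma dftn_work : writes work_arr (dftn kv.+1 h n L).
Proof. exact: sub_writes conv_work_arr (dftn_writes _ _ _ _). Qed.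

Lemma eig_work_writes m : writes work_arr (eig_work m).
Proof.
by rewrite /eig_work writes_cat writes_cat writes_cat dftn_work.
Qed.

Lemma solve_work_writes m a : writes work_arr (solve_work m a).
Proof.
rewrite /solve_work writes_cat eig_work_writes writes_cat writes_cat.
by rewrite dftn_work writes_cat dftn_work.
Qed.

Lemma kcomp_writes m i : writes no_hist (kcomp m i).
Proof.
by case: i => // d a; rewrite /= writes_cat andbT;
  apply: sub_writes work_arr_no_hist _;
  [exact: mul_work_writes | exact: solve_work_writes].
Qed.

Section Semantics.
Context {R : realType} (D : problem R) (inp : nat -> R) (c : nat -> nat -> R).
Hypotheses (adm : admissible D) (M0 : (0 < M)%N) (r0 : (0 < r)%N).
Hypothesis inpE : forall i, (i < 5)%N -> inp i = nth 0 (scalars D) i.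
Hypothesis nW : (2 * n <= W)%N.
Context (m : nat).
Hypothesis cmm : c m m = coef_a D M r m m.
Local Notation C := (complex R).
Local Notation toC := (real_complex R).
Local Notation state := (arr -> nat -> R).
Local Notation run := (vrun D W inp).
Local Notation ev := (denote D inp).
Local Notation sigma := ((Gamma (1 - p_gamma D))^-1 * c m m).

(** Agreement of an array state with a state of the Krylov method; entries beyond
    the order [n] are left unconstrained. *)
Definition krel (s : state) (st : @kstate R n) : Prop :=
  (forall d, (d <= kv)%N -> forall i : 'I_n, s (vec d) i = st.1 d i 0) /\
  (forall d, (d <= kv)%N -> s (scal d) 0%N = st.2 d).

Lemma vec_eq d e : (d <= kv)%N -> (e <= kv)%N -> (vec d == vec e) = (d == e).
Proof.
by move=> dk ek; rewrite /vec arrayE -val_eqE /= !inordK.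
Qed.

Lemma scal_eq d e : (d <= kv)%N -> (e <= kv)%N -> (scal d == scal e) = (d == e).
Proof.
by move=> dk ek; rewrite /scal arrayE -val_eqE /= !inordK.
Qed.

Lemma scal_vec d e : (scal d == vec e) = false. Proof. by apply/negbTE/eqP. Qed.

Lemma W_gt0 : (0 < W)%N. Proof. by rewrite expn_gt0. Qed.

Lemma ord_W (i : 'I_n) : (i < W)%N.
Proof.
by apply: leq_trans (ltn_ord i) (leq_trans _ nW); rewrite leq_pmull.
Qed.

Lemma krel_vec s v t d (e : nat -> expr arr) (x : 'cV[R]_n) :
  (d <= kv)%N -> krel s (v, t) ->
  (forall i : 'I_n, ev s (e i) = x i 0) ->
  krel (vexec D W inp s (vec d, e)) (upd v d x, t).
Proof.
move=> dk [sv st] H; split=> b bk /=; last first.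
  by rewrite vexec_other ?scal_vec; [exact: st | by []].
move=> i; rewrite /upd /vexec /= vec_eq // ord_W andbT.
by case: eqP => _; rewrite ?H ?sv.
Qed.

Lemma krel_scal s v t d (e : nat -> expr arr) (x : R) :
  (d <= kv)%N -> krel s (v, t) ->
  ev s (e 0%N) = x ->
  krel (vexec D W inp s (scal d, e)) (v, upd t d x).
Proof.
move=> dk [sv st] H; split=> b bk /=.
  by move=> i; rewrite vexec_other 1?eq_sym ?scal_vec; [exact: sv | by []].
rewrite /upd /vexec /= scal_eq // W_gt0 andbT.
by case: eqP => _; rewrite ?H ?st.
Qed.

Lemma krel_work p s st : writes work_arr p -> krel s st -> krel (run p s) st.
Proof.
move=> wp [sv ss]; split=> d dk.
  by move=> i; rewrite (writes_frame _ _ _ _ wp); [exact: sv | by []].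
by rewrite (writes_frame _ _ _ _ wp); [exact: ss | by []].
Qed.

Lemma load_correct (s : state) (a : arr) (w : 'cV[R]_n) j :
  (forall i : 'I_n, s a i = w i 0) -> (j < W)%N ->
  cval (run (load a) s) CX j = toC (vseq w j).
Proof.
move=> sw jW; rewrite run_cset //; last by move=> s' _; case: ifP.
rewrite /vseq; case: ifP => jn; case: insubP => [i _ ij|].
- by rewrite /ceval /= -ij sw.
- by rewrite jn.
- by have := ltn_ord i; rewrite ij jn.
- by [].
Qed.

Lemma denote_sigma s : ev s (ex_sigma m) = sigma.
Proof.
rewrite -[LHS]/(ev s ex_gamma_inv * ev s (ex_a M r m m)).
by rewrite (denote_gamma_inv inpE) (denote_a r adm M0 inpE) // cmm.
Qed.

Lemma mul_correct s v t d a : (d <= kv)%N -> (a <= kv)%N -> krel s (v, t) ->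
  krel (run (mul_prog m d a) s)
    (upd v d (sys_mx D M N r c m *m v a), t).
Proof.
move=> dk ak sv; rewrite /mul_prog vrun_cat.
have sv' := krel_work (mul_work_writes a) sv.
apply: (krel_vec dk sv') => i; rewrite ltn_ord.
have X : cval (run (mul_work a) s) CX i
    = toC (\sum_j entryA D N i.+1 (nat_of_ord j).+1 * v a j 0).
  rewrite /mul_work vrun_cat.
  rewrite (@toeplitz_correct _ _ n L _ D inp _ (fun d => toC (ev s (ex_entry N d)))
    (fun j => toC (vseq (v a) j))) //.
  - rewrite rmorph_sum; apply: eq_bigr => j _.
    by rewrite vseq_ord [RHS]rmorphM -(denote_entry N adm inpE s).
  - move=> s' p; have E (s0 : state) := denote_entry N adm inpE s0 0 p.
    by rewrite /dist sub0n add0n subn0 in E; rewrite (E s) -(E s').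
  - move=> j jW; rewrite (load_correct (sv.1 a ak) jW).
    by case: ifP => // jn; rewrite /vseq insubN ?jn.
have {}X : run (mul_work a) s (ARe CX) i
    = \sum_j entryA D N i.+1 (nat_of_ord j).+1 * v a j 0.
  by have := congr1 (@complex.Re R) X.
set s1 := run _ s in sv' X *.
rewrite -[LHS]/(ev s1 (ex_sigma m) * s1 (vec a) i
  + ev s1 (ex_kappa M N r m i.+1) * s1 (ARe CX) i).
rewrite denote_sigma (denote_kappa _ _ _ inpE) X sv'.1 //=.
rewrite /sys_mx mulmxDl mul_scalar_mx -mulmxA mul_diag_mx [RHS]mxE.
congr (_ + _); first by rewrite mxE.
rewrite !mxE; congr (_ * _).
by apply: eq_bigr => j _; rewrite !mxE.
Qed.

Local Notation pc := (fun p =>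
  (if p == 0%N then sigma else 0) + kappa_mean D M N r m * nth 0 (circ_col D N) p).

Lemma precond_circ (i j : 'I_n) :
  precond D M N r c m i j = pc ((i + (n - j)) %% n)%N.
Proof.
rewrite /precond !mxE; congr (_ + _).
have -> : ((i + (n - j)) %% n == 0)%N = (i == j); last by case: eqP.
have := ltn_ord i; have := ltn_ord j => jn iltn.
apply/eqP/eqP => [/eqP e0|->]; last by rewrite subnKC ?modnn // ltnW.
have /dvdnP[q] : (n %| i + (n - j))%N by rewrite /dvdn.
by move=> qE; apply/val_inj => /=; case: q qE => [|[|q]]; rewrite ?mulSn; lia.
Qed.

Lemma eig_correct s :
  let s' := run (eig_work m) s in
  (forall i, (i < n)%N -> cval s' CL i = circ_eig n pc i) /\
  s' AFlag 0%N = [forall k : 'I_n, circ_eig n pc k != 0]%:R.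
Proof.
rewrite /eig_work vrun_cat; set s1 := run _ s.
have s1M : s1 AMean 0%N = kappa_mean D M N r m.
  by rewrite /s1 [LHS]vexec_at ?W_gt0 // (denote_kappa_mean _ _ _ inpE).
rewrite vrun_cat; set s2 := run _ s1.
have s2X p : (p < n)%N -> cval s2 CX p = toC (pc p).
  move=> pn; rewrite /s2 run_cset ?pn //; last by lia.
  rewrite /ceval /= s1M -/(ev s1 (nth _ _ _)) (denote_circ N adm inpE).
  by case: (p == 0%N) => //; rewrite denote_sigma.
rewrite vrun_cat; set s3 := run _ s2.
have s3X i : (i < n)%N -> cval s3 CX i = circ_eig n pc i.
  move=> ilt; rewrite /s3 dftn_correct // ?ilt; last by lia.
  by apply: eq_dft => j jn; rewrite s2X.
rewrite vrun_cat; set s4 := run _ s3.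
have s4L i : (i < n)%N -> cval s4 CL i = circ_eig n pc i.
  move=> ilt; rewrite /s4 run_cset ?ceval_get ?s3X //; first by lia.
  by move=> s' Hs /=; rewrite Hs.
split=> [i ilt|].
  by rewrite /= /cval !vexec_other //; exact: s4L.
rewrite [LHS]vexec_at ?W_gt0 //=.
have E (j : 'I_n) : (if s4 (ARe CL) j * s4 (ARe CL) j
      + s4 (AIm CL) j * s4 (AIm CL) j <= 0 then 1 else 0 : R)
    = (circ_eig n pc j == 0)%:R.
  rewrite -(s4L j (ltn_ord j)) /cval eq_complex /= -!expr2.
  have := sqr_ge0 (s4 (ARe CL) j); have := sqr_ge0 (s4 (AIm CL) j) => h1 h2.
  rewrite le_eqVlt ltNge addr_ge0 // orbF paddr_eq0 // !sqrf_eq0.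
  by case: (_ && _).
under eq_bigr => j _ do rewrite E.
rewrite -natr_sum ler_nat leqn0 sum_nat_eq0.
rewrite (eq_forallb (P2 := fun k : 'I_n => circ_eig n pc k != 0)) => [|k].
  by case: [forall _, _].
by rewrite /= eqb0.
Qed.

Lemma solve_correct s v t d a : (d <= kv)%N -> (a <= kv)%N -> krel s (v, t) ->
  krel (run (solve_prog m d a) s)
    (upd v d (invmx (precond D M N r c m) *m v a), t).
Proof.
move=> dk ak sv; rewrite /solve_prog vrun_cat.
have sv' := krel_work (solve_work_writes m a) sv.
apply: (krel_vec dk sv') => i; rewrite ltn_ord.
have n0 : (0 < n)%N by have := ltn_ord i; lia.
have X j : (j < n)%N -> cval (run (solve_work m a) s) CX j
    = dft n (fun k => circ_inv_eig n pc k * dft n (fun p => toC (vseq (v a) p)) k) j.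
  move=> jn; rewrite /solve_work vrun_cat; set s1 := run _ s.
  have [s1L s1F] := eig_correct s.
  have sv1 : krel s1 (v, t) := krel_work (eig_work_writes m) sv.
  rewrite vrun_cat; set s2 := run _ s1.
  have s2X p : (p < W)%N -> cval s2 CX p = toC (vseq (v a) p).
    exact: load_correct (sv1.1 a ak).
  rewrite vrun_cat; set s3 := run _ s2.
  have s3X k : (k < n)%N ->
      cval s3 CX k = dft n (fun p => toC (vseq (v a) p)) k.
    move=> kn; rewrite /s3 dftn_correct // ?kn; last by lia.
    by apply: eq_dft => p pn; apply: s2X; lia.
  have s3L k : (k < n)%N -> cval s3 CL k = circ_eig n pc k.
    move=> kn; rewrite /s3 (cval_frame _ _ _ _ (dftn_writes _ _ _ _)) //.
    by rewrite /s2 cset_other // s1L.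
  have s3F : s3 AFlag 0%N = [forall k : 'I_n, circ_eig n pc k != 0]%:R.
    by rewrite /s3 (writes_frame _ _ _ _ (dftn_writes _ _ _ _)).
  rewrite vrun_cat dftn_correct // ?jn; last by lia.
  apply: eq_dft => k kn; have kW : (k < W)%N by lia.
  rewrite run_cset //; last by move=> s' Hs /=; rewrite !Hs.
  rewrite ceval_mul ceval_get s3X //; congr (_ * _).
  rewrite /circ_inv_eig -(s3L k kn) /ceval /cval /= s3F.
  case: [forall _, _]; rewrite ?mulr1n ?mulr0n ?subrr ?subr0 ?mul1r ?mul0r
    ?addr0 ?add0r ?sub0r // -!expr2.
rewrite -vseq_ord; set s1 := run _ s in sv' X *.
rewrite -[LHS]/(s1 (ARe CX) ((n - i) %% n)%N / n%:R).
have := congr1 (@complex.Re R) (X ((n - i) %% n)%N _).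
rewrite /= => ->; last by rewrite ltn_mod.
have := congr1 (@complex.Re R) (circ_solve precond_circ (v a) (ltn_ord i)).
rewrite /= => ->; rewrite /idft.
rewrite -(rmorph_nat toC) -fmorphV; case: (dft _ _ _) => x y /=.
by rewrite mul0r subr0 mulrC.
Qed.

Local Notation kA := (sys_mx D M N r c m).
Local Notation kP := (precond D M N r c m).

Lemma kcomp_correct i s st : all (leq^~ kv) (kindices i) -> krel s st ->
  krel (run (kcomp m i) s) (kexec kA kP st i).
Proof.
case: st => v t.
case: i => [d a|d a|d e a b|o d a b|d a|d a b|d q|o d a|o d a b];
  rewrite [all _ _]/=.
- by move=> /and3P[dk ak _]; exact: mul_correct.
- by move=> /and3P[dk ak _]; exact: solve_correct.
- move=> /and5P[dk ek ak bk _] sv; apply: (krel_vec dk sv) => i.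
  by rewrite /= sv.2 // !sv.1 // !mxE.
- move=> /and4P[dk ak bk _] sv; apply: (krel_vec dk sv) => i.
  by rewrite /= !sv.1 // !mxE.
- move=> /and3P[dk ak _] sv; apply: (krel_vec dk sv) => i.
  by rewrite /= sv.2 // mxE.
- move=> /and4P[dk ak bk _] sv; apply: (krel_scal dk sv).
  by apply: eq_bigr => i _; rewrite /= !sv.1.
- by move=> /andP[dk _] sv; exact: (krel_scal dk sv).
- move=> /and3P[dk ak _] sv; apply: (krel_scal dk sv).
  by rewrite /= sv.2.
- move=> /and4P[dk ak bk _] sv; apply: (krel_scal dk sv).
  by rewrite /= !sv.2.
Qed.

Definition kcomps (p : seq kinstr) : vprg := flatten (map (kcomp m) p).

Lemma kcomps_correct p s st : kbounded p -> krel s st ->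
  krel (run (kcomps p) s) (krun kA kP p st).
Proof.
elim: p s st => //= i p IH s st /andP[ib pb] sst.
by rewrite /kcomps /= vrun_cat; apply: IH => //; exact: kcomp_correct.
Qed.

End Semantics.
Section Cost.
Context (ninp : nat).
Hypothesis nW : (2 * n <= W)%N.
Local Notation within := (@within arr ninp W).
Local Notation work := (work L).

Lemma N_work : (N <= 2 * work)%N.
Proof.
have := W_work L; have : (0 < W)%N by rewrite expn_gt0.
by move: nW; case: (N) => [|k] /=; lia.
Qed.

Lemma ecost_sum (T : Type) k c (f : nat -> expr T) :
  (forall j, ecost (f j) = c) -> ecost (ESum k f) = (k * c.+1).+1.
Proof.
move=> fc /=; rewrite (eq_bigr (fun=> c.+1)) => [|i _]; last by rewrite fc.
by rewrite sum_nat_const card_ord.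
Qed.

Lemma edepth_sum (T : Type) k c (f : nat -> expr T) :
  (forall j, edepth (f j) <= c)%N -> (edepth (ESum k f) <= c.+1)%N.
Proof. by move=> fc; rewrite ltnS; apply/bigmax_leqP => i _. Qed.

Lemma ecost_bin (T : Type) o (e1 e2 : expr T) :
  ecost (EBin o e1 e2) = (ecost e1 + ecost e2).+1.
Proof. by []. Qed.

Lemma edepth_bin (T : Type) o (e1 e2 : expr T) :
  edepth (EBin o e1 e2) = maxn (edepth e1) (edepth e2).+1.
Proof. by []. Qed.

Lemma load_within a : within (18 * W) (load a).
Proof.
apply: (cset_within ninp (c := 2) (b := 0)) => [i _|]; last by lia.
by case: ifP; rewrite muln0.
Qed.

Lemma mul_within m d a : within (4000 * work) (mul_prog m d a).
Proof.
have := W_work L; have := N_work => NW WW.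
have T : within (814 * work + 2 * (50 * N))
    (toeplitz L (fun d => (ex_entry N d, ELit 0))).
  apply: within_leq; first apply: (toeplitz_within L ninp (c := 100) (b := 50 * N)).
    move=> i; have [c1 c2] := ex_entry_within (A := arr) N i.
    by split=> //; apply: leq_trans c2 _.
  by lia.
have F := @within1 arr ninp W 120 0 (vec d) (fun i => if (i < n)%N
  then (ex_sigma m * EGet (vec a) i + ex_kappa M N r m i.+1 * EGet (ARe CX) i)%ex
  else ELit 0).
apply: within_leq (within_cat (within_cat (load_within (vec a)) T) (F _)) _.
  by move=> i _; case: ifP; rewrite muln0.
by lia.
Qed.

Lemma kappa_mean_within m :
  (ecost (ex_kappa_mean M N r m : expr arr) <= 5 + 23 * N)%N /\
  (edepth (ex_kappa_mean M N r m : expr arr) <= stack_size)%N.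
Proof.
pose f i : expr arr := ex_kappa M N r m i.+1.
have c : ecost (ESum n f) = (n * 23).+1%N :> nat by exact: ecost_sum.
have d : (edepth (ESum n f) <= 9)%N by exact: (edepth_sum n (c := 8)).
rewrite -[ex_kappa_mean M N r m]/(ELit 1 / ELit n * ESum n f)%ex.
split; first by rewrite [ecost _]/= -/(ecost (ESum n f)) c; lia.
by rewrite [edepth _]/= -/(edepth (ESum n f)) geq_max /=; exact: leq_ltn_trans d _.
Qed.

Lemma flag_within :
  (ecost ex_flag <= 5 + 15 * N)%N /\ (edepth ex_flag <= stack_size)%N.
Proof.
pose f j : expr arr := (ex_sqnorm j <= ELit 0)%ex.
have c : ecost (ESum n f) = (n * 14).+1%N :> nat by exact: ecost_sum.
have d : (edepth (ESum n f) <= 9)%N by exact: (edepth_sum n (c := 8)).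
rewrite -[ex_flag]/(ESum n f <= ELit 0)%ex.
split; first by rewrite [ecost _]/= -/(ecost (ESum n f)) c; lia.
by rewrite [edepth _]/= -/(edepth (ESum n f)) geq_max /= andbT; apply: leq_trans d _.
Qed.

Lemma precond_within m p :
  (ecost (ex_precond_col m p) <= 200 + (p == 0%N) * (50 * N))%N /\
  (edepth (ex_precond_col m p) <= stack_size)%N.
Proof.
have [c d] := ex_circ_within (A := arr) N p.
pose e : expr arr := nth (ELit 0) (ex_circ_col N) p.
have c0 : (ecost (if p == 0%N then ex_sigma m else ELit 0) <= 80)%N.
  by case: ifP.
have d0 : (edepth (if p == 0%N then ex_sigma m else ELit 0) <= 20)%N.
  by case: ifP.
rewrite /ex_precond_col !ecost_bin !edepth_bin -/e; split.
  by move: c c0; rewrite -/e; set k := ecost e; move=> c c0 /=; lia.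
rewrite geq_max (leq_trans d0) //= gtn_max /=.
by apply: (@leq_trans 12).
Qed.

Lemma eig_within m : within (1500 * work) (eig_work m).
Proof.
have := W_work L; have := N_work => NW WW.
have P1 : within (W * (5 + 4) + 23 * N)
    [:: (AMean, fun i => if i == 0%N then ex_kappa_mean M N r m else ELit 0)].
  apply: within1 => -[|i] _ //=; rewrite mul1n.
  exact: kappa_mean_within.
have P2 : within (414 * W + 100 * N)
    (cset CX (fun p => if (p < n)%N then (ex_precond_col m p, ELit 0) else czero)).
  apply: (cset_within ninp (c := 200) (b := 50 * N)) => [i _|]; last by lia.
  have [c d] := precond_within m i.
  by case: ifP => _; split=> //; exact: leq_trans (leq_addr _ _).
have P3 : within (18 * W) (cset CL (cget CX)).
  by apply: (cset_within ninp (c := 2) (b := 0)) => [i _|]; rewrite ?muln0 //; lia.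
have P4 : within (W * (5 + 4) + 15 * N)
    [:: (AFlag, fun i => if i == 0%N then ex_flag else ELit 0)].
  apply: within1 => -[|i] _ //=; rewrite mul1n.
  exact: flag_within.
apply: within_leq (within_cat P1 (within_cat P2 (within_cat
  (dftn_within kv.+1 h n L ninp) (within_cat P3 P4)))) _.
by lia.
Qed.

Lemma solve_within m d a : within (4000 * work) (solve_prog m d a).
Proof.
have := W_work L; have := N_work => NW WW.
have P1 : within (154 * W)
    (cset CX (fun i => cmul (ex_inv_eig i) (cget CX i))).
  by apply: (cset_within ninp (c := 70) (b := 0)) => [i _|]; rewrite ?muln0 //; lia.
have P2 : within (W * (4 + 4) + 0) [:: (vec d, fun i => if (i < n)%N
         then (EGet (ARe CX) ((n - i) %% n) / ELit n)%ex else ELit 0)].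
  by apply: within1 => i _; case: ifP; rewrite muln0.
have Dn := dftn_within kv.+1 h n L ninp.
apply: within_leq (within_cat (within_cat (eig_within m) (within_cat
  (load_within (vec a)) (within_cat Dn (within_cat P1 Dn)))) P2) _.
by lia.
Qed.

(** Each instruction costs at most a constant number of fast transforms; the
    constant is a generous count for a preconditioner solve. *)
Lemma kcomp_within m i : within (4000 * work) (kcomp m i).
Proof.
have := W_work L; have := N_work => NW WW.
have small d (e : nat -> expr arr) : (forall i, (ecost (e i) <= 10)%N) ->
    (forall i, (edepth (e i) <= stack_size)%N) -> within (4000 * work) [:: (d, e)].
  move=> He De; apply: within_leq.
    by apply: (within1 ninp (c := 10) (b := 0) d) => j _;
      rewrite muln0 addn0 He De.
  by lia.
case: i => [d a|d a|d e a b|o d a b|d a|d a b|d q|o d a|o d a b];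
  rewrite /kcomp; try exact: small.
- exact: mul_within.
- exact: solve_within.
pose f j : expr arr := (EGet (vec a) j * EGet (vec b) j)%ex.
have c : ecost (ESum n f) = (n * 6).+1%N :> nat by exact: ecost_sum.
have dd : (edepth (ESum n f) <= 9)%N by exact: (edepth_sum n (c := 8)).
apply: within_leq.
  apply: (within1 ninp (c := 10) (b := 6 * N) (scal d)) => -[|j] _ //.
  split; last exact: leq_trans dd _.
  by change (ecost (ESum n f) <= 10 + 1 * (6 * N))%N; rewrite c; lia.
by lia.
Qed.

Lemma kcomps_within m p : within (size p * (4000 * work)) (kcomps m p).
Proof.
elim: p => [|i p IH]; first exact: within_nil.
by rewrite [size _]/= (mulSn (size p)); exact: within_cat (kcomp_within m i) IH.
Qed.

End Cost.
End Krylov.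

(** * Time stepping *)

Section Levels.
Context (kry : krylov) (kv q M N r L : nat).
Hypothesis kv0 : (0 < kv)%N.
Local Notation n := (N.-1).
Local Notation W := (2 ^ L)%N.
Local Notation arr := (array kv.+1 q.+1).
Local Notation vprg := (vprog arr).
Local Notation vec := (vec kv q.+1).
Local Notation scal := (scal kv q.+1).
Local Notation kcomps := (kcomps kv q.+1 M N r L).

Definition hist (j : nat) : arr := AHist (inord j).

Definition clear (f : nat -> arr) (l : seq nat) : vprg :=
  [seq (f d, fun=> ELit 0) | d <- l].

Definition solve_level (m it : nat) : vprg :=
  clear vec (iota 2 kv.-1) ++ clear scal (iota 0 kv.+1)
  ++ kcomps m (k_init kry) ++ flatten (nseq it (kcomps m (k_step kry))).

Definition init_level : vprg :=
  [:: (vec 0, fun i => if (i < n)%N then EPhi (ex_x N i.+1) else ELit 0)].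

(** In level [m] of FIDS the array [hist j] with [j < q] holds the [j]-th
    exponential history sum, [hist q] the solution before the previous one. *)
Definition fids_update (m j : nat) : vprg :=
  [:: (hist j, fun i =>
     EUn OExp ((ELit 0 - EIn (5 + j)) * (ex_t M r m - ex_t M r m.-1))
       * EGet (hist j) i
     + ex_b M r j m m.-1 * (EGet (vec 0) i - EGet (hist q) i))%ex].

Definition fids_history (m : nat) : vprg :=
  (if m == 1%N then init_level
   else flatten [seq fids_update m j | j <- iota 0 q])
  ++ [:: (hist q, EGet (vec 0));
         (vec 1, fun i => if (i < n)%N then
            (ex_gamma_inv * (ex_a M r m m * EGet (vec 0) i
              - ESum q (fun j => EIn (5 + q + j) * EGet (hist j) i))
             + ex_f M N r m i.+1)%ex else ELit 0)].

(** In DIDS the array [hist k] holds [u^k]. *)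
Definition dids_history (m : nat) : vprg :=
  (if m == 1%N then init_level else [::])
  ++ [:: (hist m.-1, EGet (vec 0));
         (vec 1, fun i => if (i < n)%N then
            (ex_gamma_inv * (ESum m.-1 (fun k =>
                 (ex_a M r m k.+2 - ex_a M r m k.+1) * EGet (hist k.+1) i)
               + ex_a M r m 1 * EGet (hist 0) i)
             + ex_f M N r m i.+1)%ex else ELit 0)].

Section Cost.
Context (ninp : nat).
Hypothesis nW : (2 * n <= W)%N.
Local Notation within := (@within arr ninp W).
Local Notation work := (work L).

Lemma clear_within f l : within (size l * (5 * W)) (clear f l).
Proof.
elim: l => [|d l IH]; first exact: within_nil.
rewrite [size _]/= (mulSn (size l)); apply: (within_cat (p := [:: _]) _ IH).
apply: within_leq.
  by apply: (within1 ninp (c := 1) (b := 0)) => i _; rewrite muln0.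
by lia.
Qed.

Lemma solve_level_within m it :
  within ((2 * kv) * (5 * W)
          + (size (k_init kry) + it * size (k_step kry)) * (4000 * work))
    (solve_level m it).
Proof.
have steps : within (it * (size (k_step kry) * (4000 * work)))
    (flatten (nseq it (kcomps m (k_step kry)))).
  elim: it => [|i IH]; first exact: within_nil.
  by rewrite (mulSn i); apply: within_cat IH; exact: kcomps_within.
have init : within (size (k_init kry) * (4000 * work)) (kcomps m (k_init kry)).
  exact: kcomps_within.
apply: within_leq (within_cat (clear_within vec (iota 2 kv.-1)) (within_cat
  (clear_within scal (iota 0 kv.+1)) (within_cat init steps))) _.
rewrite !size_iota mulnDl -!mulnA; move: (size (k_step kry) * _)%N => x.
by case: kv kv0 => // k _; lia.
Qed.

Lemma init_level_within : within (20 * W) init_level.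
Proof.
apply: within_leq.
  apply: (within1 ninp (c := 15) (b := 0)) => i _; rewrite muln0.
  by case: ifP.
by lia.
Qed.

Lemma fids_history_within m : (0 < q)%N ->
  within (600 * (W * q)) (fids_history m).
Proof.
move=> q0; have Wq : (W <= W * q)%N by rewrite leq_pmulr.
have upd j : within (110 * W) (fids_update m j).
  apply: within_leq.
    by apply: (within1 ninp (c := 105) (b := 0)) => i _; rewrite muln0.
  by lia.
have upds l : within (size l * (110 * W)) (flatten [seq fids_update m j | j <- l]).
  elim: l => [|j l IH]; first exact: within_nil.
  by rewrite [size _]/= (mulSn (size l)); exact: within_cat (upd j) IH.
have P1 : within (130 * (W * q)) (if m == 1%N then init_level
   else flatten [seq fids_update m j | j <- iota 0 q]).
  case: ifP => _; first by apply: within_leq init_level_within _; lia.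
  by apply: within_leq (upds _) _; rewrite size_iota; lia.
have P2 : within (10 * W) [:: (hist q, EGet (vec 0))].
  apply: within_leq.
    by apply: (within1 ninp (c := 2) (b := 0)) => i _; rewrite muln0.
  by lia.
apply: within_leq.
  apply: (within_cat P1 (within_cat P2 (q := [:: _]) _)).
  apply: (within1 ninp (c := 120 + 6 * q) (b := 0)) => i _; rewrite muln0 addn0.
  case: ifP => _ //; pose f j : expr arr := (EIn (5 + q + j) * EGet (hist j) i)%ex.
  have c : ecost (ESum q f) = (q * 6).+1%N :> nat by exact: ecost_sum.
  have d : (edepth (ESum q f) <= 9)%N by exact: (edepth_sum q (c := 8)).
  rewrite !ecost_bin !edepth_bin -/f c; move: d; set k := edepth _ => d.
  split; first by rewrite /=; lia.
  by rewrite !(geq_max, gtn_max) /stack_size /=; lia.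
by lia.
Qed.

Lemma dids_history_within m : (0 < q)%N -> (m <= q)%N ->
  within (600 * (W * q)) (dids_history m).
Proof.
move=> q0 mq; have Wq : (W <= W * q)%N by rewrite leq_pmulr.
have P1 : within (20 * W) (if m == 1%N then init_level else [::]).
  case: ifP => _; first exact: init_level_within.
  by apply: within_leq (within_nil _ _ _) _.
have P2 : within (10 * W) [:: (hist m.-1, EGet (vec 0))].
  apply: within_leq.
    by apply: (within1 ninp (c := 2) (b := 0)) => i _; rewrite muln0.
  by lia.
apply: within_leq.
  apply: (within_cat P1 (within_cat P2 (q := [:: _]) _)).
  apply: (within1 ninp (c := 120 + 150 * q) (b := 0)) => i _.
  rewrite muln0 addn0; case: ifP => _ //.
  pose f k : expr arr :=
    ((ex_a M r m k.+2 - ex_a M r m k.+1) * EGet (hist k.+1) i)%ex.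
  have c : ecost (ESum m.-1 f) = (m.-1 * 141).+1%N :> nat by exact: ecost_sum.
  have d : (edepth (ESum m.-1 f) <= 19)%N by exact: (edepth_sum m.-1 (c := 18)).
  rewrite !ecost_bin !edepth_bin -/f c; move: d; set k := edepth _ => d.
  split; first by rewrite /=; lia.
  by rewrite !(geq_max, gtn_max) /stack_size /=; lia.
by lia.
Qed.

End Cost.
Section Semantics.
Context {R : realType} (D : problem R) (inp : nat -> R).
Hypotheses (adm : admissible D) (M0 : (0 < M)%N) (r0 : (0 < r)%N).
Hypothesis inpE : forall i, (i < 5)%N -> inp i = nth 0 (scalars D) i.
Hypothesis nW : (2 * n <= W)%N.
Local Notation state := (arr -> nat -> R).
Local Notation run := (vrun D W inp).
Local Notation ev := (denote D inp).

Lemma run_pair (p1 p2 : arr * (nat -> expr arr)) (s : state) :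
  run [:: p1; p2] s = vexec D W inp (vexec D W inp s p1) p2.
Proof. by []. Qed.

Lemma run_clear f l s a i :
  run (clear f l) s a i = if (a \in map f l) && (i < W)%N then 0 else s a i.
Proof.
elim: l s => //= d l IH s; rewrite IH inE /vexec /=.
by case: (a == f d); case: (_ \in _); case: (i < W)%N.
Qed.

Lemma hist_eq j k : (j <= q)%N -> (k <= q)%N -> (hist j == hist k) = (j == k).
Proof. by move=> jq kq; rewrite /hist arrayE -val_eqE /= !inordK. Qed.

Lemma clear_writes f l (P : pred arr) : (forall d, P (f d)) -> writes P (clear f l).
Proof. by move=> Pf; rewrite /writes all_map; apply/allP => d _ /=. Qed.

Lemma solve_level_hist m it s j :
  run (solve_level m it) s (hist j) = s (hist j).
Proof.
have K p : writes (@no_hist kv q.+1) (kcomps m p).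
  elim: p => // a p IH.
  by rewrite -[kcomps m _]/(kcomp _ _ _ _ _ _ _ _ ++ _) writes_cat kcomp_writes.
have steps : writes (@no_hist kv q.+1)
    (flatten (nseq it (kcomps m (k_step kry)))).
  by elim: it => // k IH; rewrite /= writes_cat K.
have wp : writes (@no_hist kv q.+1) (solve_level m it).
  by rewrite /solve_level !writes_cat !clear_writes // K.
by rewrite (writes_frame _ _ _ _ wp).
Qed.

Lemma solve_level_correct c m it (s : state) (x0 b : 'cV[R]_n) (i : 'I_n) :
  kbounded kv (k_init kry) -> kbounded kv (k_step kry) ->
  c m m = coef_a D M r m m ->
  (forall i : 'I_n, s (vec 0) i = x0 i 0) ->
  (forall i : 'I_n, s (vec 1) i = b i 0) ->
  run (solve_level m it) s (vec 0) i
    = ksolve (sys_mx D M N r c m) (precond D M N r c m) kry it x0 b i 0.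
Proof.
move=> init_ok step_ok cmm sx sb; rewrite /solve_level !vrun_cat.
set s1 := run (clear scal _) _.
have K1 : krel s1 (upd (upd (fun=> 0) 0 x0) 1 b, fun=> 0).
  split=> d dk; rewrite /s1.
    move=> k; have kW := ord_W nW k; rewrite run_clear ifN; last first.
      rewrite negb_and; apply/orP; left; apply/mapP => -[e _ /eqP].
      by rewrite eq_sym scal_vec.
    rewrite run_clear kW andbT /=.
    have [d2|d2] := ltnP 1 d.
      rewrite map_f ?mem_iota; last by lia.
      by rewrite /upd !ifN ?mxE //; lia.
    rewrite ifN; last first.
      apply/mapP => -[e]; rewrite mem_iota => ie /eqP.
      by rewrite vec_eq //; lia.
    by case: d d2 dk => [|[|]].
  by rewrite run_clear map_f ?mem_iota ?expn_gt0 //; lia.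
have K2 := kcomps_correct adm M0 r0 inpE nW cmm init_ok K1.
move: K2; set s2 := run _ s1; set st := krun _ _ _ _ => K2.
have K3 : krel (run (flatten (nseq it (kcomps m (k_step kry)))) s2)
    (iter it (krun (sys_mx D M N r c m) (precond D M N r c m) (k_step kry)) st).
  elim: it s2 st K2 => // k IH s2 st K2; rewrite iterSr /= vrun_cat.
  by apply: IH; exact: kcomps_correct.
exact: (K3.1 0%N (leq0n _) i).
Qed.

Lemma init_level_correct s (i : 'I_n) :
  run init_level s (vec 0) i = vec0 D N i 0.
Proof.
rewrite [LHS]vexec_at ?(ord_W nW) // ltn_ord mxE.
by rewrite -[LHS]/(p_phi D (ev s (ex_x N i.+1))) (denote_x N inpE).
Qed.

Lemma sum_by_parts (a x : nat -> R) m : (0 < m)%N ->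
  \sum_(1 <= k < m) (a k.+1 - a k) * x k + a 1%N * x 0%N
    = a m * x m.-1 - \sum_(1 <= k < m) a k * (x k - x k.-1).
Proof.
elim: m => // -[|m] IH _; first by rewrite !big_nil subr0 add0r.
rewrite big_nat_recr //= [in RHS]big_nat_recr //= addrAC (IH isT) /=.
by ring.
Qed.

(** After summation by parts each [c m k] stands alone, and a sum of exponentials
    can be inserted for it. *)
Lemma rhs_by_parts c (u : nat -> 'cV[R]_n) m (i : 'I_n) : (0 < m)%N ->
  rhs D M r c u m i 0 = (Gamma (1 - p_gamma D))^-1 *
    (c m m * u m.-1 i 0 - \sum_(1 <= k < m) c m k * (u k i 0 - u k.-1 i 0))
    + p_f D (grid_x D N i.+1) (grid_t D M r m).
Proof.
move=> m0; rewrite /rhs !mxE summxE; congr (_ * _ + _).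
under eq_bigr do rewrite mxE.
exact: (sum_by_parts (c m) (fun k => u k i 0)).
Qed.

Section FIDS.
Context (sw w : 'I_q -> R).
Hypotheses (sw0 : forall j, 0 < sw j)
           (inp_s : forall j : 'I_q, inp (5 + j)%N = sw j)
           (inp_w : forall j : 'I_q, inp (5 + q + j)%N = w j).
Local Notation s0 := ((fun _ _ => 0) : state).
Local Notation B j m k := (ev s0 (ex_b M r j m k)).
Local Notation diff u k i := (u k i 0 - u k.-1 i 0).

Definition fids_hist (u : nat -> 'cV[R]_n) m j (i : 'I_n) : R :=
  \sum_(1 <= k < m) B j m k * diff u k i.

(** Between two levels every past contribution of an exponential decays by the
    same factor; only the latest difference enters with a new coefficient. *)
Lemma fids_hist_step u m j i : (0 < m)%N ->
  fids_hist u m.+1 j i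
    = ev s0 (EUn OExp ((ELit 0 - EIn (5 + j)) * (ex_t M r m.+1 - ex_t M r m))%ex)
        * fids_hist u m j i + B j m.+1 m * diff u m i.
Proof.
move=> m0; rewrite /fids_hist big_nat_recr //= mulr_sumr; congr (_ + _).
apply: eq_bigr => k _; rewrite mulrA; congr (_ * _).
rewrite /= !(mulrA (expR _)); congr (_ / _ / _).
by rewrite [RHS]mulrBr -!expRD; congr (expR _ - expR _); ring.
Qed.

Definition fids_inv (u : nat -> 'cV[R]_n) m (s : state) : Prop :=
  ((0 < m)%N -> forall i : 'I_n,
     s (vec 0) i = u m i 0 /\ s (hist q) i = u m.-1 i 0) /\
  (forall j, (j < q)%N -> forall i : 'I_n, s (hist j) i = fids_hist u m j i).

Lemma run_updates m s k : (k <= q)%N ->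
  let s' := run (flatten [seq fids_update m j | j <- iota 0 k]) s in
  [/\ s' (vec 0) = s (vec 0), s' (hist q) = s (hist q)
    & forall j i, (j < q)%N -> (i < W)%N -> s' (hist j) i =
        if (j < k)%N then
          ev s0 (EUn OExp ((ELit 0 - EIn (5 + j)) * (ex_t M r m - ex_t M r m.-1))%ex)
            * s (hist j) i + B j m m.-1 * (s (vec 0) i - s (hist q) i)
        else s (hist j) i].
Proof.
elim: k => [|k IH] kq; first by split.
have [I1 I2 I3] := IH (ltnW kq).
rewrite flatten_iotaS vrun_cat; set s1 := run _ s.
have qk : hist q != hist k by rewrite hist_eq // ?(ltnW kq) //; lia.
split.
- by rewrite [LHS]vexec_other.
- by rewrite [LHS]vexec_other.
move=> j i jq iW; have [->|jk] := eqVneq j k.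
  rewrite [LHS]vexec_at // ltnS leqnn.
  have E := I3 k i kq iW; rewrite ltnn in E.
  by rewrite -I1 -I2 -E.
have -> : run (fids_update m k) s1 (hist j) = s1 (hist j).
  by apply: vexec_other; rewrite hist_eq // ltnW.
have -> : (j < k.+1)%N = (j < k)%N by rewrite ltnS leq_eqVlt (negbTE jk).
exact: I3.
Qed.

Lemma fids_history_correct u m s : (0 < m)%N -> u 0%N = vec0 D N ->
  fids_inv u m.-1 s ->
  let s' := run (fids_history m) s in
  [/\ forall i : 'I_n, s' (vec 0) i = u m.-1 i 0,
      forall i : 'I_n, s' (vec 1) i = rhs D M r (coef_b D M r sw w) u m i 0,
      forall i : 'I_n, s' (hist q) i = u m.-1 i 0
    & forall j, (j < q)%N -> forall i : 'I_n, s' (hist j) i = fids_hist u m j i].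
Proof.
move=> m0 u0 [Iu Ih]; rewrite /fids_history vrun_cat; set s1 := run _ s.
have [s1v s1h] : (forall i : 'I_n, s1 (vec 0) i = u m.-1 i 0) /\
    forall j, (j < q)%N -> forall i : 'I_n, s1 (hist j) i = fids_hist u m j i.
  rewrite {}/s1; have [m1|m1] := eqVneq m 1%N.
    rewrite m1 in Ih *; split=> [i|j jq i].
      by rewrite init_level_correct u0.
    have -> : run init_level s (hist j) = s (hist j) by apply: vexec_other.
    by rewrite (Ih j jq i) /fids_hist [LHS]big_geq // [RHS]big_geq.
  have [p mp] : exists p, m = p.+2 by exists m.-2; lia.
  rewrite {}mp in Iu Ih *; have [R1 R2 R3] := run_updates p.+2 s (leqnn q).
  split=> [i|j jq i]; first by rewrite R1; exact: (Iu isT i).1.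
  rewrite R3 ?(ord_W nW) // jq Ih // (Iu isT i).1 (Iu isT i).2.
  by rewrite [RHS]fids_hist_step.
have vh j : vec 0 != hist j by [].
have hv d j : hist j != vec d by [].
have v01 : vec 0 != vec 1 by rewrite vec_eq.
rewrite run_pair; set s2 := vexec D W inp s1 (hist q, EGet (vec 0)).
have s2v : s2 (vec 0) = s1 (vec 0) by rewrite /s2 vexec_other.
have s2h j : (j < q)%N -> s2 (hist j) = s1 (hist j).
  by move=> jq; rewrite /s2 vexec_other // hist_eq //; lia.
split=> [i|i|i|j jq i].
- by rewrite vexec_other // s2v.
- rewrite vexec_at ?(ord_W nW) // ltn_ord rhs_by_parts //.
  rewrite -[LHS]/(ev s2 ex_gamma_inv * (ev s2 (ex_a M r m m) * s2 (vec 0) i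
    - \sum_(j < q) inp (5 + q + j)%N * s2 (hist j) i) + ev s2 (ex_f M N r m i.+1)).
  rewrite (denote_gamma_inv inpE) (denote_a r adm M0 inpE) //.
  rewrite (denote_f _ _ _ inpE) s2v s1v.
  congr (_ * (_ * _ - _) + _); first by rewrite /coef_b eqxx.
  rewrite (eq_bigr (fun j => w j * \sum_(1 <= k < m) B j m k * diff u k i));
    last by move=> j _; rewrite inp_w s2h // s1h.
  under eq_bigr do rewrite mulr_sumr.
  rewrite exchange_big /=; apply: eq_big_nat => k /andP[k0 km].
  rewrite (denote_b r adm M0 inpE _ s0 km sw0 inp_s) mulr_suml.
  by apply: eq_bigr => j _; rewrite mulrA.
- by rewrite vexec_other // /s2 vexec_at ?(ord_W nW) //=.
- by rewrite vexec_other // s2h // s1h.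
Qed.

End FIDS.

Section DIDS.

Definition dids_inv (u : nat -> 'cV[R]_n) m (s : state) : Prop :=
  ((0 < m)%N -> forall i : 'I_n, s (vec 0) i = u m i 0) /\
  (forall k, (k < m)%N -> forall i : 'I_n, s (hist k) i = u k i 0).

Lemma dids_history_correct u m s : (0 < m <= q)%N -> u 0%N = vec0 D N ->
  dids_inv u m.-1 s ->
  let s' := run (dids_history m) s in
  [/\ forall i : 'I_n, s' (vec 0) i = u m.-1 i 0,
      forall i : 'I_n, s' (vec 1) i = rhs D M r (coef_a D M r) u m i 0
    & forall k, (k < m)%N -> forall i : 'I_n, s' (hist k) i = u k i 0].
Proof.
move=> /andP[m0 mq] u0 [Iu Ih]; rewrite /dids_history vrun_cat; set s1 := run _ s.
have [s1v s1h] : (forall i : 'I_n, s1 (vec 0) i = u m.-1 i 0) /\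
    forall k, (k < m.-1)%N -> forall i : 'I_n, s1 (hist k) i = u k i 0.
  rewrite {}/s1; have [m1|m1] := eqVneq m 1%N.
    by rewrite m1; split=> // i; rewrite init_level_correct u0.
  by split=> // i; apply: Iu; lia.
have vh j : vec 0 != hist j by [].
have hv d j : hist j != vec d by [].
have v01 : vec 0 != vec 1 by rewrite vec_eq.
rewrite run_pair; set s2 := vexec D W inp s1 (hist m.-1, EGet (vec 0)).
have s2v : s2 (vec 0) = s1 (vec 0) by rewrite /s2 vexec_other.
have s2h k : (k < m)%N -> forall i : 'I_n, s2 (hist k) i = u k i 0.
  move=> km i; have [->|km1] := eqVneq k m.-1.
    by rewrite /s2 vexec_at ?(ord_W nW) //= s1v.
  rewrite /s2 vexec_other ?s1h //; first by lia.
  by rewrite hist_eq //; lia.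
split=> [i|i|k km i].
- by rewrite vexec_other // s2v.
- rewrite vexec_at ?(ord_W nW) // ltn_ord.
  rewrite -[LHS]/(ev s2 ex_gamma_inv * (\sum_(k < m.-1)
      (ev s2 (ex_a M r m k.+2) - ev s2 (ex_a M r m k.+1)) * s2 (hist k.+1) i
    + ev s2 (ex_a M r m 1) * s2 (hist 0) i) + ev s2 (ex_f M N r m i.+1)).
  rewrite (denote_gamma_inv inpE) (denote_a r adm M0 inpE) //.
  rewrite (denote_f _ _ _ inpE) s2h // /rhs !mxE summxE.
  congr (_ * (_ + _) + _).
  rewrite big_add1 big_mkord; apply: eq_bigr => k _; have := ltn_ord k => km.
  rewrite !(denote_a r adm M0 inpE) ?s2h ?mxE //; lia.
- by rewrite vexec_other // s2h.
Qed.

End DIDS.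

End Semantics.
End Levels.

(** * The schemes as straight-line programs *)

(** The right-hand side of a level involves all the previous levels. *)
Lemma course_of_values (T : Type) (x0 : T) (step : (nat -> T) -> nat -> T) :
  (forall u u' m, (0 < m)%N -> (forall k, (k < m)%N -> u k = u' k) ->
     step u m = step u' m) ->
  exists u, u 0%N = x0 /\ forall m, (0 < m)%N -> u m = step u m.
Proof.
move=> Hstep.
pose table := fix t m : nat -> T :=
  if m is p.+1 then upd (t p) p.+1 (step (t p) p.+1) else fun=> x0.
have tableE k m : (k <= m)%N -> table m k = table k k.
  elim: m => [|m IH]; first by rewrite leqn0 => /eqP ->.
  rewrite leq_eqVlt => /predU1P[->//|km].
  by rewrite /= /upd (ltn_eqF km) IH.
exists (fun m => table m m); split=> // -[//|m] _.
rewrite [LHS]/= /upd eqxx; apply: Hstep => // k km.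
by rewrite tableE.
Qed.

Lemma scheme_levels_exist {R : realType} (D : problem R) M N r kry it c :
  exists u : nat -> 'cV[R]_N.-1, u 0%N = vec0 D N /\
    forall m, (0 < m)%N ->
      u m = ksolve (sys_mx D M N r c m) (precond D M N r c m) kry (it m)
              (u m.-1) (rhs D M r c u m).
Proof.
apply: course_of_values => u u' m m0 H; congr ksolve; first by apply: H; lia.
rewrite /rhs H //; congr (_ *: (_ + _) + _).
by apply: eq_big_nat => k /andP[_ km]; rewrite H.
Qed.

Section Programs.
Context (kry : krylov) (kv q M N r L ninp : nat) (it : nat -> nat).
Hypothesis kv0 : (0 < kv)%N.
Hypothesis nW : (2 * N.-1 <= 2 ^ L)%N.
Local Notation n := (N.-1).
Local Notation W := (2 ^ L)%N.
Local Notation arr := (array kv.+1 q.+1).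
Local Notation vec := (vec kv q.+1).
Context (history : nat -> vprog arr).

Definition level (m : nat) : vprog arr :=
  history m ++ solve_level kry kv q M N r L m (it m).

Definition program : seq (seq instr) :=
  [seq vcomp ninp W (level m) | m <- iota 1 M].

Definition out_reg (i : 'I_n) : nat := addr ninp W (vec 0) i.

Lemma size_program : size program = M.
Proof. by rewrite size_map size_iota. Qed.

(** The invariant of the levels also covers the history arrays, which is why it
    is a parameter; the array state starts at zero, as the registers do. *)
Lemma program_correct {R : realType} (D : problem R) (inputs : seq R)
    (inv : nat -> (arr -> nat -> R) -> Prop) (u : nat -> 'cV[R]_n) :
  size inputs = ninp -> inv 0%N (fun _ _ => 0) ->
  (forall m s, (0 < m <= M)%N -> inv m.-1 s ->
     inv m (vrun D W (nth 0 inputs) (level m) s)) ->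
  (forall m s, (0 < m)%N -> inv m s -> forall i : 'I_n, s (vec 0) i = u m i 0) ->
  computes_levels D M inputs program out_reg u.
Proof.
move=> sz inv0 invS invE m i /andP[m0 mM].
have inp_out j : (ninp <= j)%N -> nth 0 inputs j = 0.
  by move=> jn; rewrite nth_default // sz.
have start : simulates ninp W (nth 0 inputs) (nth 0 inputs)
    (fun (_ : arr) _ => 0).
  split=> // a j jW; rewrite nth_default // sz.
  by apply: leq_trans (addr_ge _ _ _ _); rewrite leq_addr.
have run_m k : (k <= M)%N -> exists2 s,
    simulates ninp W (nth 0 inputs)
      (run D (flatten (take k program)) (nth 0 inputs)) s & inv k s.
  elim: k => [_|k IH kM]; first by exists (fun _ _ => 0); rewrite ?take0.
  have [s ss sk] := IH (ltnW kM).
  exists (vrun D W (nth 0 inputs) (level k.+1) s); last exact: invS.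
  rewrite (take_nth [::]) ?size_program // flatten_rcons run_cat.
  rewrite (nth_map 0%N) ?size_iota // nth_iota // add1n.
  exact: vcomp_correct.
have [s [_ sa _] sm] := run_m m mM.
have iW : (i < W)%N := ord_W nW i.
by rewrite /out_reg sa // (invE m).
Qed.

Lemma program_within itmax : (0 < q)%N -> (forall m, it m <= itmax)%N ->
  (forall m, (0 < m <= M)%N -> within ninp W (600 * (W * q)) (history m)) ->
  let K := (600 + 10 * kv
            + 4000 * (size (k_init kry) + itmax * size (k_step kry)))%N in
  (num_ops program <= M * (K * (W * (L.+1 + q))))%N /\
  (num_regs ninp program <= ninp + W + #|{: arr}| * W + stack_size)%N.
Proof.
move=> q0 itm Hh K.
have level_within m : (0 < m <= M)%N -> within ninp W (K * (W * (L.+1 + q))) (level m).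
  move=> mM; apply: within_leq (within_cat (Hh m mM)
    (solve_level_within kry q M r kv0 ninp nW m (it m))) _.
  rewrite /K /work; have := itm m; set a := size (k_init _); set b := size _ => im.
  have ib : (a + it m * b <= a + itmax * b)%N by rewrite leq_add2l leq_mul2r im orbT.
  have h1 : (W * q <= W * (L.+1 + q))%N by rewrite leq_mul2l leq_addl orbT.
  have h2 : (W <= W * (L.+1 + q))%N by rewrite leq_pmulr.
  have h3 : (W * L.+1 <= W * (L.+1 + q))%N by rewrite leq_mul2l leq_addr orbT.
  have h4 : ((a + it m * b) * (4000 * (W * L.+1))
      <= (a + itmax * b) * (4000 * (W * (L.+1 + q))))%N.
    exact: leq_mul ib (leq_mul (leqnn 4000) h3).
  have h5 : (2 * kv * (5 * W) <= 2 * kv * (5 * (W * (L.+1 + q))))%N.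
    by rewrite !leq_mul2l h2 !orbT.
  by move: h1 h4 h5; set x := (W * (L.+1 + q))%N; lia.
have all_level l : all (fun m => 0 < m <= M)%N l ->
    (size (flatten [seq vcomp ninp W (level m) | m <- l])
       <= size l * (K * (W * (L.+1 + q))))%N /\
    all (fun i => all (ltn^~ (stack_base arr ninp W + stack_size)%N) (instr_regs i))
      (flatten [seq vcomp ninp W (level m) | m <- l]).
  elim: l => // m l IH /= /andP[/level_within[s1 a1] /IH[s2 a2]].
  by rewrite size_cat mulSn leq_add // all_cat a1 a2.
have [|s1 a1] := all_level (iota 1 M).
  by apply/allP => m; rewrite mem_iota; lia.
split; first by rewrite /num_ops /program; move: s1; rewrite size_iota.
rewrite /program (map_comp (vcomp ninp W) level).
by apply: num_regs_vcomp; rewrite -map_comp.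
Qed.

End Programs.

Section Bounds.
Context {R : realType}.

(** The least power of two that can host the circulant embedding of a Toeplitz
    matrix of order [N - 1]. *)
Definition width_log (N : nat) : nat := up_log 2 (2 * N.-1).

Lemma width_ge N : (2 * N.-1 <= 2 ^ width_log N)%N.
Proof. exact: up_logP. Qed.

Lemma width_le N : (0 < N)%N -> (2 ^ width_log N <= 4 * N)%N.
Proof.
case: N => // -[|k] _; first by rewrite /width_log up_log0.
have n1 : (1 < 2 * k.+1)%N by lia.
rewrite /width_log; have := up_log_bounds (isT : 1 < 2)%N n1.
case: (up_log _ _) => [|j] /=; first by rewrite expn0; lia.
by rewrite expnS; lia.
Qed.

Lemma width_log_le N : (0 < N)%N ->
  (width_log N)%:R <= 2 + (ln 2)^-1 * ln N%:R :> R.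
Proof.
move=> N0; have l2 : 0 < ln 2 :> R by rewrite ln_gt0 // ltr1n.
rewrite -(ler_pM2r l2) mulrDl mulrAC mulVf ?gt_eqF // mul1r.
rewrite !mulr_natl -!lnXn ?ltr0n // -lnM ?posrE ?exprn_gt0 ?ltr0n //.
rewrite ler_ln ?posrE ?mulr_gt0 ?exprn_gt0 ?ltr0n //.
by rewrite -natrX -natrX -natrM ler_nat width_le.
Qed.

Lemma ops_bound (M N q K x : nat) : (0 < N)%N -> (0 < q)%N ->
  (x <= M * (K * (2 ^ width_log N * ((width_log N).+1 + q))))%N ->
  x%:R <= K%:R * 4 * (4 + (ln 2)^-1) * (M%:R * N%:R * (ln N%:R + q%:R)) :> R.
Proof.
move=> N0 q0; rewrite -(ler_nat R) => /le_trans; apply.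
have l2 : 0 < (ln 2)^-1 :> R by rewrite invr_gt0 ln_gt0 // ltr1n.
have lN : 0 <= ln N%:R :> R by rewrite ln_ge0 // ler1n.
have q1 : 1 <= q%:R :> R by rewrite ler1n.
have h1 : (2 ^ width_log N)%:R <= 4 * N%:R :> R.
  by rewrite -natrM ler_nat width_le.
have h2 : ((width_log N).+1 + q)%:R <= (4 + (ln 2)^-1) * (ln N%:R + q%:R) :> R.
  rewrite natrD -natr1; have := width_log_le N0.
  have : 0 <= (ln 2)^-1 * q%:R :> R by rewrite mulr_ge0 // ltW.
  by rewrite mulrDl !mulrDr; lra.
rewrite !natrM.
have -> : K%:R * 4 * (4 + (ln 2)^-1) * (M%:R * N%:R * (ln N%:R + q%:R))
  = M%:R * (K%:R * ((4 * N%:R) * ((4 + (ln 2)^-1) * (ln N%:R + q%:R)))) :> R.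
  by ring.
by do 2 (apply: ler_wpM2l; first exact: ler0n); exact: ler_pM.
Qed.

Lemma regs_bound (N q kv ninp x : nat) : (0 < N)%N -> (0 < q)%N ->
  (ninp <= 5 + 2 * q)%N ->
  (x <= ninp + 2 ^ width_log N
        + (11 + 2 * kv.+1 + q.+1) * 2 ^ width_log N + stack_size)%N ->
  (x <= (150 + 8 * kv) * (N * q))%N.
Proof.
move=> N0 q0 ni /leq_trans; apply; have := width_le N0.
set w := (2 ^ _)%N => wN.
have h1 : (q <= N * q)%N by rewrite leq_pmull.
have h2 : (N <= N * q)%N by rewrite leq_pmulr.
have h3 : (1 <= N * q)%N by rewrite muln_gt0 N0.
have h4 : ((11 + 2 * kv.+1 + q.+1) * w <= (11 + 2 * kv.+1 + q.+1) * (4 * N))%N.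
  by rewrite leq_mul2l wN orbT.
have h5 : (kv * N <= kv * (N * q))%N by rewrite leq_mul2l h2 orbT.
by rewrite /stack_size; move: h1 h2 h3 h4 h5; rewrite mulnDl; nia.
Qed.

End Bounds.

(** The successor makes room for vectors 0 and 1, which hold the iterate and the
    right-hand side even if the method never names them. *)
Definition kbound (kry : krylov) : nat :=
  (\max_(d <- flatten (map kindices (k_init kry ++ k_step kry))) d).+1.

Lemma kbound_ok kry :
  kbounded (kbound kry) (k_init kry) && kbounded (kbound kry) (k_step kry).
Proof.
rewrite /kbounded -all_cat /kbound; set p := _ ++ _.
rewrite -(all_map kindices (all _)) -all_flatten; apply/allP => d dp.
by apply: leqW; exact: (leq_bigmax_seq (F := id)).
Qed.

Theorem proposition3p1 (R : realType) (kry : krylov) (itmax : nat) :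
  exists C : R,
    (* FIDS *)
    (forall (M N r Nexp : nat) (it : nat -> nat),
       (0 < M)%N -> (0 < N)%N -> (0 < r)%N -> (0 < Nexp)%N ->
       (forall m, (it m <= itmax)%N) ->
       exists (ps : seq (seq instr)) (out : 'I_N.-1 -> nat),
         [/\ size ps = M,
             (num_ops ps)%:R <= C * (M%:R * N%:R * (ln N%:R + Nexp%:R)),
             (num_regs (5 + 2 * Nexp) ps)%:R <= C * (N%:R * Nexp%:R)
           & forall (D : problem R) (s w : 'I_Nexp -> R) (eps : R),
               admissible D -> soe_approx D M r s w eps ->
               exists u : nat -> 'cV[R]_N.-1,
                 scheme_levels D M r kry it (coef_b D M r s w) u /\
                 computes_levels D M
                   (scalars D ++ codom s ++ codom w) ps out u])
    /\
    (* DIDS *)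
    (forall (M N r : nat) (it : nat -> nat),
       (0 < M)%N -> (0 < N)%N -> (0 < r)%N ->
       (forall m, (it m <= itmax)%N) ->
       exists (ps : seq (seq instr)) (out : 'I_N.-1 -> nat),
         [/\ size ps = M,
             (num_ops ps)%:R <= C * (M%:R * N%:R * (ln N%:R + M%:R)),
             (num_regs 5 ps)%:R <= C * (N%:R * M%:R)
           & forall (D : problem R),
               admissible D ->
               exists u : nat -> 'cV[R]_N.-1,
                 scheme_levels D M r kry it (coef_a D M r) u /\
                 computes_levels D M (scalars D) ps out u]).
Proof.
have /andP[init_ok step_ok] := kbound_ok kry.
have kv0 : (0 < kbound kry)%N by [].
pose K := (600 + 10 * kbound kry
  + 4000 * (size (k_init kry) + itmax * size (k_step kry)))%N.
pose C1 : R := K%:R * 4 * (4 + (ln 2)^-1).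
pose C2 : R := (150 + 8 * kbound kry)%:R.
have C1_ge0 : 0 <= C1.
  by rewrite !mulr_ge0 // addr_ge0 // invr_ge0 ltW // ln_gt0 // ltr1n.
have C2_ge0 : 0 <= C2 by [].
have ops_le (M N q x : nat) : (0 < N)%N -> (0 < q)%N ->
    (x <= M * (K * (2 ^ width_log N * ((width_log N).+1 + q))))%N ->
    x%:R <= (C1 + C2) * (M%:R * N%:R * (ln N%:R + q%:R)).
  move=> N0 q0 /(ops_bound (R := R) N0 q0) /le_trans; apply.
  rewrite ler_wpM2r ?lerDl // !mulr_ge0 // addr_ge0 // ln_ge0 // ler1n //.
have regs_le (N q ninp x : nat) : (0 < N)%N -> (0 < q)%N ->
    (ninp <= 5 + 2 * q)%N ->
    (x <= ninp + 2 ^ width_log N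
        + #|{: array (kbound kry).+1 q.+1}| * 2 ^ width_log N + stack_size)%N ->
    x%:R <= (C1 + C2) * (N%:R * q%:R).
  move=> N0 q0 ni; rewrite card_array => /(regs_bound N0 q0 ni) xle.
  apply: (@le_trans _ _ (C2 * (N%:R * q%:R))).
    by rewrite -!natrM ler_nat.
  by rewrite ler_wpM2r ?lerDr // mulr_ge0.
(* Both bounds only get weaker when the other constant is added. *)
exists (C1 + C2); split=> [M N r q it M0 N0 r0 q0 itm|M N r it M0 N0 r0 itm].
- have nW := width_ge N; set L := width_log N in nW *.
  pose hp := fids_history (kbound kry) q M N r.
  pose ninp := (5 + 2 * q)%N.
  exists (program kry M N r L ninp it hp), (@out_reg (kbound kry) q N L ninp).
  have [ops regs] := program_within kry r kv0 nW q0 itm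
    (fun m (_ : (0 < m <= M)%N) => fids_history_within M r kv0 ninp nW m q0).
  split; [exact: size_program | exact: (ops_le _ _ _ _ N0 q0 ops)
    | by apply: (regs_le _ _ _ _ N0 q0 _ regs)|].
  move=> D s w eps adm [_ s0 _ _].
  set inputs := scalars D ++ codom s ++ codom w; pose inp := nth 0 inputs.
  have sz : size inputs = ninp.
    by rewrite /inputs !size_cat !size_codom !card_ord /ninp /=; lia.
  have inpE i : (i < 5)%N -> inp i = nth 0 (scalars D) i.
    by move=> i5; rewrite /inp nth_cat /= i5.
  have nth_codom (f : 'I_q -> R) (j : 'I_q) : nth 0 (codom f) j = f j.
    by rewrite codomE (nth_map j) ?nth_ord_enum // size_enum_ord.
  have inp_s (j : 'I_q) : inp (5 + j)%N = s j.
    rewrite -[LHS]/(nth 0 (codom s ++ codom w) j) nth_cat size_codom card_ord.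
    by rewrite ltn_ord nth_codom.
  have inp_w (j : 'I_q) : inp (5 + q + j)%N = w j.
    rewrite -[LHS]/(nth 0 (codom s ++ codom w) (q + j)) nth_cat size_codom.
    by rewrite card_ord ltnNge leq_addr addKn nth_codom.
  have [u [u0 uS]] := scheme_levels_exist D M N r kry it (coef_b D M r s w).
  exists u; split; first by split=> // m /andP[m0 _]; exact: uS.
  apply: (@program_correct _ _ _ _ _ _ _ _ _ nW hp R D inputs
    (fids_inv M r D inp u)); first exact: sz.
  + by split=> // j jq i; rewrite /fids_hist big_geq.
  + move=> m st /andP[m0 mM] Hinv.
    rewrite /level vrun_cat; set st1 := vrun _ _ _ (hp m) st.
    have [H1 H2 H3 H4] := fids_history_correct kv0 adm M0 r0 inpE nW s0 inp_s inp_w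
      m0 u0 Hinv.
    split=> [_ i|j jq i]; last by rewrite solve_level_hist; exact: H4.
    split; last by rewrite solve_level_hist; exact: H3.
    rewrite (uS m m0).
    apply: (solve_level_correct kv0 adm M0 r0 inpE nW _ _ init_ok step_ok _ H1 H2).
    by rewrite /coef_b eqxx.
  + by move=> m st m0 [H _] i; exact: (H m0 i).1.
- have nW := width_ge N; set L := width_log N in nW *.
  pose hp := dids_history (kbound kry) M M N r.
  exists (program kry M N r L 5 it hp), (@out_reg (kbound kry) M N L 5).
  have [ops regs] := program_within kry r kv0 nW M0 itm
    (fun m mM => dids_history_within M r kv0 5 nW M0 (proj2 (andP mM))).
  split; [exact: size_program | exact: (ops_le _ _ _ _ N0 M0 ops)
    | by apply: (regs_le _ _ _ _ N0 M0 _ regs)|].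
  move=> D adm; have inpE i : (i < 5)%N -> nth 0 (scalars D) i = nth 0 (scalars D) i.
    by [].
  have [u [u0 uS]] := scheme_levels_exist D M N r kry it (coef_a D M r).
  exists u; split; first by split=> // m /andP[m0 _]; exact: uS.
  apply: (@program_correct _ _ _ _ _ _ _ _ _ nW hp R D (scalars D)
    (@dids_inv _ _ N _ u)); first by [].
  + by split.
  + move=> m st /andP[m0 mM] Hinv; rewrite /level vrun_cat.
    have [|H1 H2 H3] := dids_history_correct kv0 adm M0 r0 inpE nW (m := m) _ u0 Hinv.
      by rewrite m0.
    split=> [_ i|k km i]; last by rewrite solve_level_hist; exact: H3.
    rewrite (uS m m0).
    exact: (solve_level_correct kv0 adm M0 r0 inpE nW _ _ init_ok step_ok _ H1 H2).
  + by move=> m st m0 [H _] i; exact: H.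
Qed.
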